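(* Let $\mathbb{P}$ be the set of prime numbers, let $\mathrm{cpx}_{\mathbf{1}_{\mathbb{P}}}(n)$ be the complexity of the subshift $X_{\mathbf{1}_{\mathbb{P}}}$ generated by the (symmetrized) indicator of the primes, and let $\mathrm{cpx}_{X_{\mathbb{P}}}(n)$ be the complexity of the $\mathbb{P}$-admissible subshift $X_{\mathbb{P}}$. Then, as $n\to\infty$, $$\mathrm{cpx}_{\mathbf{1}_{\mathbb{P}}}(n)\ll (4+o(1))^{n/\log n}$$ and $$(2+o(1))^{n/\log n}\ll \mathrm{cpx}_{X_{\mathbb{P}}}(n)\ll (4+o(1))^{n/\log n}.$$ Moreover, if the Hardy-Littlewood $k$-tuple conjecture is true, then, as $n\to\infty$, $$(2+o(1))^{n/\log n}\ll \mathrm{cpx}_{\mathbf{1}_{\mathbb{P}}}(n).$$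
   Context: $\log$ is the natural logarithm. $S$ is the left shift on $\{0,1\}^{\mathbb{Z}}$, $(Sz)(n)=z(n+1)$. For $y\in\{0,1\}^{\mathbb{Z}}$, $X_y:=\overline{\{S^jy: j\in\mathbb{Z}\}}$ (product topology). For $A\subset\mathbb{N}=\{1,2,\ldots\}$, $X_{\mathbf{1}_A}$ means $X_y$ with $y$ the indicator function of $A\cup(-A)$ on $\mathbb{Z}$ (so $y(0)=0$). For a subshift $X$ (closed shift-invariant subset of $\{0,1\}^{\mathbb{Z}}$), $\mathrm{cpx}_X(n)$ is the number of distinct blocks (words) of length $n$ appearing in elements of $X$; $\mathrm{cpx}_y:=\mathrm{cpx}_{X_y}$. A set $A\subset\mathbb{Z}$ is $\mathbb{P}$-admissible if for every prime $p$ the set $A$ misses at least one residue class modulo $p$. $X_{\mathbb{P}}$ is the set of all $x\in\{0,1\}^{\mathbb{Z}}$ whose support $\{i: x(i)=1\}$ is $\mathbb{P}$-admissible. $f(n)\ll (c+o(1))^{g(n)}$ means: there are a constant $C>0$ and a sequence $\varepsilon_n\to0$ with $f(n)\le C(c+\varepsilon_n)^{g(n)}$ for all sufficiently large $n$; similarly $(c+o(1))^{g(n)}\ll f(n)$ means $f(n)\ge C(c+\varepsilon_n)^{g(n)}$ for some $C>0$, $\varepsilon_n\to 0$ and all sufficiently large $n$. Hardy-Littlewood $k$-tuple conjecture: for every $k\ge1$ and every $\mathbb{P}$-admissible set $\{h_1,\ldots,h_k\}$ of $k$ distinct integers, $|\{n\le X: n+h_1,\ldots,n+h_k \text{ are all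 prime}\}|\sim \mathfrak{C}\,X/\log^k X$ as $X\to\infty$, where $\mathfrak{C}=\prod_{p}(1-\nu(p)/p)(1-1/p)^{-k}>0$ and $\nu(p)$ is the number of residue classes mod $p$ occupied by $h_1,\ldots,h_k$. *)

(* Defs.v *)
From HB Require Import structures.
From mathcomp Require Import all_boot all_order all_algebra.
From mathcomp Require Import all_classical all_reals all_analysis.

Set Implicit Arguments.
Unset Strict Implicit.
Unset Printing Implicit Defensive.

Import Order.TTheory GRing.Theory Num.Theory.
Import numFieldNormedType.Exports.
Local Open Scope classical_set_scope.
Local Open Scope ring_scope.

(* {0,1}^Z with the product topology, bool being discrete *)
Definition bisequence := prod_topology (fun _ : int => bool).

(* S^j for the left shift (S z)(n) = z(n + 1), j an arbitrary integer *)
Definition shift (j : int) (z : bisequence) : bisequence := fun n => z (n + j).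

Definition orbit_closure (y : bisequence) : set bisequence :=
  closure [set shift j y | j in [set: int]].

Definition sym_indicator (A : set nat) : bisequence :=
  fun i => `[< exists2 a : nat, A a & i = a%:Z \/ i = - a%:Z >].

Definition occurs_in n (w : n.-tuple bool) (x : bisequence) : Prop :=
  exists i : int, forall k : 'I_n, x (i + k%:Z) = tnth w k.

Definition cpx (X : set bisequence) (n : nat) : nat :=
  #|[set w : n.-tuple bool | `[< exists2 x, X x & occurs_in w x >]]%SET|.

Definition admissible (A : set int) : Prop :=
  forall p : nat, prime p ->
    exists r : int, forall a : int, A a -> (a != r %[mod p%:Z])%Z.

Definition admissible_subshift : set bisequence :=
  [set x | admissible [set i | x i]].

Definition primes_subshift : set bisequence :=
  orbit_closure (sym_indicator [set p | prime p]).

Definition ll_pow (R : realType) (f : nat -> R) (c : R) (g : nat -> R) : Prop :=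
  exists (C : R) (eps : nat -> R),
    [/\ 0 < C, eps n @[n --> \oo] --> 0
      & \forall n \near \oo, f n <= C * (c + eps n) `^ g n].

Definition pow_ll (R : realType) (c : R) (g : nat -> R) (f : nat -> R) : Prop :=
  exists (C : R) (eps : nat -> R),
    [/\ 0 < C, eps n @[n --> \oo] --> 0
      & \forall n \near \oo, C * (c + eps n) `^ g n <= f n].

Definition prime_int (z : int) : bool := if z is Posz m then prime m else false.

Definition residue_count (h : seq int) (p : nat) : nat :=
  size (undup [seq (a %% p%:Z)%Z | a <- h]).

(* Euler product, as the limit of its partial products over the primes p < N *)
Definition singular_series (R : realType) (k : nat) (h : k.-tuple int) : R :=
  lim ((\prod_(0 <= p < N | prime p)
          ((1 - (residue_count h p)%:R / p%:R) / (1 - p%:R^-1) ^+ k) : R)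
       @[N --> \oo]).

(* the number of integers 1 <= n <= X with all n + h_i prime *)
Definition tuple_count (R : realType) (k : nat) (h : k.-tuple int) (X : R) : nat :=
  count (fun n : nat => all (fun a => prime_int (n%:Z + a)) h)
        (iota 1 (Num.truncn X)).

Definition hardy_littlewood (R : realType) : Prop :=
  forall (k : nat) (h : k.-tuple int),
    (0 < k)%N -> uniq h -> admissible [set` h] ->
    (tuple_count h X)%:R / (singular_series R h * (X / ln X ^+ k))
      @[X --> +oo] --> (1 : R).

(* Main.v *)
(** A word of length [n] is admissible iff its support avoids a residue class modulo every prime.

    Upper bound.  For a cutoff [z], the Chinese remainder theorem gives a single [c < z!] such
    that the support, shifted by [c], consists of integers free of prime factors [<= z].  By
    Selberg's sieve an interval of length [n] contains at most [n / ln z + z^(2 + o(1))] such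
    integers, so there are at most [z! * 2 ^ M] admissible words, where
    [M ~ 2 n / ln n] for [z = n ^ (1/2 - eps)].  A window of the primes is admissible unless it
    lies within distance [O(n)] of the origin, which accounts for [O(n)] further words.

    Lower bound.  The prime number theorem is not needed: by Mertens' estimate for the sum of
    [ln p / p], averaging over the windows [(j n, (j + 1) n]] with [1 <= j < K] yields one with
    at least [(1 - o(1)) n / ln n] primes.  They form an admissible set since [j n >= n].

    Under the Hardy-Littlewood conjecture every nonzero admissible word is a word of the primes:
    if [m + a] is prime for all [a] in the support but the word does not occur at [m], then
    [m + b] is prime for a further [b], and such [m] are rarer by a factor [ln X]. *)

Require Import Defs.
From HB Require Import structures.
From mathcomp Require Import all_boot all_order all_algebra.
From mathcomp Require Import all_classical all_reals all_analysis.
From mathcomp Require Import zify ring lra.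

Set Implicit Arguments.
Unset Strict Implicit.
Unset Printing Implicit Defensive.

Import Order.TTheory GRing.Theory Num.Theory.
Import numFieldNormedType.Exports.
Local Open Scope ring_scope.

(** * Square-free moduli as sets of primes *)

Lemma prod_primes_dvdn (s : seq nat) (m : nat) : uniq s ->
  {in s, forall p, prime p} -> {in s, forall p, p %| m}%N -> (\prod_(p <- s) p %| m)%N.
Proof.
elim: s => [|q s IH] /=; first by rewrite big_nil dvd1n.
move=> /andP[qs us] hp hm; rewrite big_cons Gauss_dvd.
  rewrite hm ?mem_head//= IH// => p ps; [apply: hp|apply: hm];
  by rewrite inE ps orbT.
rewrite coprime_sym big_seq; elim/big_ind: _ => [|x y hx hy|p ps].
- exact: coprime1n.
- by rewrite coprimeMl hx.
- have pp : prime p by apply: hp; rewrite inE ps orbT.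
  have pq : prime q by apply: hp; rewrite mem_head.
  rewrite prime_coprime// dvdn_prime2//.
  by apply: contra qs => /eqP <-.
Qed.

Section PrimeSets.
Local Open Scope nat_scope.
Variable z : nat.
Implicit Types P Q K : {set 'I_z.+1}.

(** A square-free integer with prime factors at most [z] is encoded by the set of these factors, so
    that lcm, gcd and exact quotient become union, intersection and difference of sets. *)
Definition setprod P : nat := \prod_(p in P) p.

Definition prime_set P := [forall p in P, prime p].

Lemma prime_setP P : reflect (forall p : 'I_z.+1, p \in P -> prime p) (prime_set P).
Proof. exact: forall_inP. Qed.

Lemma prime_setS P Q : P \subset Q -> prime_set Q -> prime_set P.
Proof.
by move=> /fintype.subsetP PQ /prime_setP hQ; apply/prime_setP => p /PQ /hQ.
Qed.

Lemma prime_setU P Q : prime_set P -> prime_set Q -> prime_set (P :|: Q).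
Proof.
move=> /prime_setP hP /prime_setP hQ; apply/prime_setP => p.
by rewrite inE => /orP[/hP|/hQ].
Qed.

Lemma setprod_gt0 P : prime_set P -> (0 < setprod P)%N.
Proof. by move=> /prime_setP hP; apply: prodn_cond_gt0 => p /hP /prime_gt0. Qed.

Lemma dvdn_setprod P (m : nat) : prime_set P ->
  (setprod P %| m) = [forall p in P, p %| m].
Proof.
move=> /prime_setP hP; apply/idP/forall_inP => [+ p pP|].
  by apply: dvdn_trans; rewrite /setprod (bigD1 p)//= dvdn_mulr.
move=> h; rewrite /setprod -big_enum -(big_map (@nat_of_ord _) predT id).
apply: prod_primes_dvdn; first by rewrite map_inj_uniq ?enum_uniq//; exact: ord_inj.
  by move=> _ /mapP[p + ->]; rewrite mem_enum; exact: hP.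
by move=> _ /mapP[p + ->]; rewrite mem_enum; exact: h.
Qed.

Lemma prime_dvdn_setprod P (p : 'I_z.+1) : prime_set P -> prime p ->
  (p %| setprod P) = (p \in P).
Proof.
move=> /prime_setP hP pp; apply/idP/idP => [|pP].
  rewrite Euclid_dvd_prod// big_has_cond => /hasP[q _ /andP[qP]].
  by rewrite dvdn_prime2 ?(hP q)// => /eqP/ord_inj ->.
by rewrite /setprod (bigD1 p)//= dvdn_mulr.
Qed.

Lemma setprod_inj : {in prime_set &, injective setprod}.
Proof.
move=> P Q hP hQ e; apply/finset.setP => p.
have [pp|np] := boolP (prime p); first by rewrite -!prime_dvdn_setprod// e.
move/prime_setP: hP => hP; move/prime_setP: hQ => hQ.
by apply/idP/idP => [/hP|/hQ]; rewrite (negbTE np).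
Qed.

Lemma setprodUI P Q : (setprod (P :|: Q) * setprod (P :&: Q) = setprod P * setprod Q)%N.
Proof.
rewrite /setprod (big_setID (A := Q) P)/= (big_setID (A := P :|: Q) P)/=.
have -> : (P :|: Q) :&: P = P by apply/finset.setP => x; rewrite !inE; case: (x \in P); rewrite ?orbT ?andbF.
have -> : (P :|: Q) :\: P = Q :\: P by apply/finset.setP => x; rewrite !inE; case: (x \in P).
by rewrite (big_setID (A := P) Q)/= (finset.setIC Q P); lia.
Qed.

Lemma setprod_sub P Q : P \subset Q -> setprod Q = (setprod P * setprod (Q :\: P))%N.
Proof.
by move=> PQ; rewrite /setprod (big_setID (A := Q) P)/= (finset.setIidPr PQ).
Qed.

Definition small_sets : {set {set 'I_z.+1}} :=
  [set P : {set 'I_z.+1} | prime_set P && (setprod P <= z)%N]%SET.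

Lemma small_setsP P : reflect (prime_set P /\ (setprod P <= z)%N) (P \in small_sets).
Proof. by rewrite inE; apply: andP. Qed.

Lemma small_setsS P Q : P \subset Q -> Q \in small_sets -> P \in small_sets.
Proof.
move=> PQ /small_setsP[hQ zQ]; apply/small_setsP; split; first exact: prime_setS hQ.
apply: leq_trans zQ; rewrite (setprod_sub PQ) leq_pmulr//.
by apply: setprod_gt0; apply: prime_setS hQ; rewrite finset.subsetDl.
Qed.

Lemma small_sets0 : (0 < z)%N -> finset.set0 \in small_sets.
Proof.
move=> z0; apply/small_setsP; split; first by apply/prime_setP => p; rewrite inE.
by rewrite /setprod big_set0.
Qed.

Lemma card_small_sets : (#|small_sets| <= z)%N.
Proof.
pose f (P : {set 'I_z.+1}) : 'I_z.+1 := inord (setprod P).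
have fE P : P \in small_sets -> f P = setprod P :> nat.
  by move=> /small_setsP[_ ?]; rewrite /f inordK// ltnS.
have finj : {in small_sets &, injective f}.
  move=> P Q hP hQ e; have /small_setsP[pP _] := hP; have /small_setsP[pQ _] := hQ.
  by apply: setprod_inj => //; rewrite -!fE// e.
rewrite -(card_in_imset finj).
have : f @: small_sets \subset [set~ ord0]%SET.
  apply/fintype.subsetP => _ /finset.imsetP[P hP ->]; rewrite !inE -val_eqE/= -lt0n fE//.
  by have /small_setsP[/setprod_gt0] := hP.
by move=> /fintype.subset_leq_card /leq_trans; apply; rewrite cardsC1 card_ord.
Qed.

Lemma card_small_set P : P \in small_sets -> (#|P| <= trunc_log 2 z)%N.
Proof.
move=> /small_setsP[/prime_setP hP zP]; apply: trunc_log_max => //.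
apply: leq_trans zP; rewrite -prod_nat_const; apply: leq_prod => p /hP.
exact: prime_gt1.
Qed.

End PrimeSets.

(** * Expansions over the subsets of a finite set *)

Section Expansions.
Variables (R : realFieldType) (T : finType).
Implicit Types P Q K : {set T}.

Lemma prod_in1D P (F : T -> R) :
  \prod_(x in P) (1 + F x) = \sum_(K : {set T} | K \subset P) \prod_(x in K) F x.
Proof.
rewrite big_mkcond/= (eq_bigr (fun x => (if x \in P then F x else 0) + 1)); last first.
  by move=> x _; case: ifP => _; rewrite ?add0r// addrC.
rewrite bigA_distr (bigID (fun K : {set T} => K \subset P))/= [X in _ + X]big1 ?addr0.
  apply: eq_big => // K KP; rewrite [RHS]big_mkcond/=; apply: eq_bigr => x _.
  by case: ifPn => // xK; rewrite (fintype.subsetP KP).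
move=> K /fintype.subsetPn[x xK xP]; rewrite (bigD1 x)//= xK (negbTE xP) mul0r//.
Qed.

(** Möbius inversion on the lattice of subsets. The sum factors over the points of [T]: a point of
    [Q] outside [K] contributes [-1 + 1] and a point of [K] outside [Q] contributes [0 + 0], so only
    [K = Q] survives. *)
Lemma sum_signed_interval K Q :
  \sum_(P : {set T} | (K \subset P) && (P \subset Q)) (-1) ^+ #|P| =
  (if K == Q then (-1) ^+ #|K| else 0) :> R.
Proof.
transitivity (\prod_x ((if x \in Q then -1 else 0) + (if x \in K then 0 else 1)) : R).
  rewrite bigA_distr [RHS](bigID (fun P : {set T} => (K \subset P) && (P \subset Q)))/=.
  rewrite [X in _ = _ + X]big1 ?addr0.
    apply: eq_bigr => P /andP[KP PQ]; rewrite -prodr_const big_mkcond/=.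
    apply: eq_bigr => x _; case: ifPn => xP; first by rewrite (fintype.subsetP PQ).
    by case: ifP => // /(fintype.subsetP KP); rewrite (negbTE xP).
  move=> P; rewrite negb_and => /orP[] /fintype.subsetPn[x h1 h2]; rewrite (bigD1 x)//=.
    by rewrite (negbTE h2) h1 mul0r.
  by rewrite h1 (negbTE h2) mul0r.
have [->|/eqP KQ] := eqVneq K Q.
  rewrite -prodr_const [RHS]big_mkcond/=; apply: eq_bigr => x _.
  by case: ifP => _; rewrite ?addr0 ?add0r.
have [x hx] : exists x, (x \in K) != (x \in Q).
  apply/existsP; rewrite -negb_forall; apply/negP => /forallP h; apply: KQ.
  by apply/finset.setP => x; exact/eqP.
rewrite (bigD1 x)//=; move: hx; case: (x \in K); case: (x \in Q) => // _.
  by rewrite addr0 mul0r.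
by rewrite addNr mul0r.
Qed.

End Expansions.

(** * Selberg's sieve *)

(** The ceiling [(m + d.-1) %/ d] counts the multiples of [d] in [[0, m)]; those in [[0, n + c)] are
    split at [c]. *)
Lemma sum_dvdn_shift (d n c : nat) : (0 < d)%N ->
  (\sum_(k < n) (d %| k + c) + (c + d.-1) %/ d = (n + c + d.-1) %/ d)%N.
Proof.
move=> d0; elim: n => [|n IH]; first by rewrite big_ord0 !add0n.
rewrite big_ord_recr/= addnAC IH !addSn divnS// addnC; congr (_ + _)%N.
rewrite -addnS prednK//. by rewrite (@dvdn_addl d d).
Qed.

Lemma count_dvdn_shift (R : realFieldType) (d n c : nat) : (0 < d)%N ->
  `|(\sum_(k < n) (d %| k + c)%N)%:R - n%:R / d%:R| <= 1 :> R.
Proof.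
move=> d0; have := sum_dvdn_shift n c d0.
set s := (\sum_(k < n) _)%N; move=> e.
have [h1 h2] : (s * d <= n + d /\ n <= s * d + d)%N.
  have := divn_eq (c + d.-1) d; have := ltn_pmod (c + d.-1) d0.
  have := divn_eq (n + c + d.-1) d; have := ltn_pmod (n + c + d.-1) d0.
  by rewrite -e; move: d0; clear; nia.
have d0' : 0 < d%:R :> R by rewrite ltr0n.
rewrite ler_norml lerBrDr lerBlDr; apply/andP; split.
  rewrite -(ler_pM2r d0') mulrDl mulN1r divfK ?gt_eqF// -natrM addrC lerBlDr -natrD ler_nat; lia.
rewrite -(ler_pM2r d0') mulrDl mul1r divfK ?gt_eqF// -natrM -natrD ler_nat; lia.
Qed.

Section Selberg.
Variables (R : realFieldType) (z n c : nat).
Hypothesis z_gt0 : (0 < z)%N.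
Implicit Types P Q K : {set 'I_z.+1}.
Let D := small_sets z.
Let N P : R := (setprod P)%:R.

(** This is 1/phi(d) for the integer d encoded by [P]; [sieve_mass] is then Selberg's sum of mu(d)^2
    / phi(d) over d <= z. *)
Definition inv_totient P : R := \prod_(p in P) (p%:R - 1)^-1.
Let w := inv_totient.
Definition sieve_mass : R := \sum_(P in D) inv_totient P.
Let G := sieve_mass.

(* Selberg's optimal weights *)
Let lam P : R := (-1) ^+ #|P| * N P * \sum_(Q in D | P \subset Q) w Q.

Lemma inv_totient_gt0 P : prime_set P -> 0 < inv_totient P.
Proof.
move=> /prime_setP hP; apply: prodr_gt0 => p /hP/prime_gt1 pp.
by rewrite invr_gt0 subr_gt0 ltr1n.
Qed.

Let small_prime P : P \in D -> prime_set P.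
Proof. by case/small_setsP. Qed.

Let w_gt0 P : P \in D -> 0 < w P.
Proof. by move/small_prime/inv_totient_gt0. Qed.

Let N_gt0 P : P \in D -> 0 < N P.
Proof. by move/small_prime/setprod_gt0; rewrite /N ltr0n. Qed.

Lemma sieve_mass_gt0 : 0 < sieve_mass.
Proof.
rewrite /sieve_mass (bigD1 finset.set0) ?small_sets0//= ltr_pwDl//.
  by apply: w_gt0; exact: small_sets0.
by apply: sumr_ge0 => P /andP[/w_gt0/ltW].
Qed.

(** These sums are the variables that diagonalize Selberg's quadratic form. Exchanging the
    summations leaves an alternating sum over the sets between [K] and [Q], which vanishes unless
    [K = Q]. *)
Let lam_moebius K :
  \sum_(P in D | K \subset P) lam P / N P = if K \in D then (-1) ^+ #|K| * w K else 0.
Proof.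
transitivity (\sum_(Q in D) w Q * \sum_(P : {set 'I_z.+1} | (K \subset P) && (P \subset Q)) (-1) ^+ #|P|).
  under [RHS]eq_bigr do rewrite big_distrr/=.
  rewrite (exchange_big_dep (fun P : {set 'I_z.+1} => (P \in D) && (K \subset P)))/=; last first.
    by move=> Q P QD /andP[-> PQ]; rewrite (small_setsS PQ).
  apply: eq_bigr => P /andP[PD KP]; rewrite /lam mulrAC mulfK ?gt_eqF ?N_gt0//.
  by rewrite big_distrr/=; apply: eq_big => [Q|Q _]; rewrite ?KP// mulrC.
under eq_bigr do rewrite sum_signed_interval.
case: ifPn => KD.
  rewrite (bigD1 K)//= eqxx big1 ?addr0 1?mulrC// => Q /andP[_ QK].
  by rewrite eq_sym (negbTE QK) mulr0.
rewrite big1// => Q QD; case: eqP => [e|_]; last by rewrite mulr0.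
by rewrite e QD in KD.
Qed.

(** The identity d = sum of phi(k) over k dividing d, obtained by writing each prime as 1 + (p -
    1). *)
Let NE P : N P = \sum_(K : {set 'I_z.+1} | K \subset P) \prod_(p in K) (p%:R - 1).
Proof.
rewrite /N /setprod natr_prod -prod_in1D; apply: eq_bigr => p _.
by rewrite addrC subrK.
Qed.

(** Since 1/lcm(d, e) = gcd(d, e) / (d e) and the gcd is a sum of phi over common divisors, the form
    becomes a sum of squares weighted by phi, which [lam_moebius] evaluates. *)
Let main_term :
  \sum_(P in D) \sum_(Q in D) lam P * lam Q / N (P :|: Q) = G.
Proof.
transitivity (\sum_(P in D) \sum_(Q in D) \sum_(K : {set 'I_z.+1} | (K \subset P) && (K \subset Q))
   (\prod_(p in K) (p%:R - 1)) * ((lam P / N P) * (lam Q / N Q)) : R).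
  apply: eq_bigr => P PD; apply: eq_bigr => Q QD.
  rewrite -big_distrl/=.
  have -> : \sum_(K : {set 'I_z.+1} | (K \subset P) && (K \subset Q)) \prod_(p in K) (p%:R - 1)
     = N (P :&: Q).
    by rewrite NE; apply: eq_bigl => K; rewrite finset.subsetI.
  have e : N (P :|: Q) * N (P :&: Q) = N P * N Q by rewrite /N -!natrM setprodUI.
  have PQ0 : N (P :|: Q) != 0.
    by rewrite /N pnatr_eq0 -lt0n setprod_gt0// prime_setU// small_prime.
  have P0 : N P != 0 by rewrite gt_eqF ?N_gt0.
  have Q0 : N Q != 0 by rewrite gt_eqF ?N_gt0.
  have -> : N (P :&: Q) = N P * N Q / N (P :|: Q) by rewrite -e mulrC mulKf.
  by field; rewrite P0 Q0 PQ0.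
under eq_bigr => P PD.
  rewrite (exchange_big_dep (fun K : {set 'I_z.+1} => K \subset P))/=; last by move=> Q K _ /andP[].
  over.
rewrite (exchange_big_dep predT)//=.
transitivity (\sum_(K : {set 'I_z.+1}) (\prod_(p in K) (p%:R - 1)) *
   (\sum_(P in D | K \subset P) lam P / N P) ^+ 2 : R).
  apply: eq_bigr => K _; rewrite expr2 big_distrl/= big_distrr/=.
  apply: eq_bigr => P /andP[PD KP]; rewrite big_distrr/= big_distrr/=.
  by apply: eq_bigl => Q; rewrite KP.
rewrite /G /sieve_mass [RHS]big_mkcond/=; apply: eq_bigr => K _.
rewrite lam_moebius; case: ifPn => KD; last by rewrite expr0n/= mulr0.
rewrite exprMn sqrr_sign mul1r expr2 mulrA.
rewrite /w /inv_totient -big_split/= big1 ?mul1r// => p pK.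
rewrite mulfV// subr_eq0 pnatr_eq1; move/small_prime/prime_setP : KD => /(_ _ pK).
by case: (val p) => [|[]].
Qed.

(** For [Q] containing [P], [w Q] is [w P * w (Q :\: P)], and [Q :\: P] runs injectively through
    members of [D], whose total weight is [G]. *)
Let lam_bound P : P \in D -> `|lam P| <= N P * w P * G.
Proof.
move=> PD; rewrite /lam !normrM normrX normrN1 expr1n mul1r.
rewrite (gtr0_norm (N_gt0 PD)) -mulrA ler_pM2l ?N_gt0// ger0_norm; last first.
  by apply: sumr_ge0 => Q /andP[/w_gt0/ltW].
rewrite big_distrr/=.
rewrite (eq_bigr (fun Q => w P * w (Q :\: P))); last first.
  move=> Q /andP[QD PQ]; rewrite /w /inv_totient (big_setID (A := Q) P)/=.
  by rewrite (finset.setIidPr PQ).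
rewrite (eq_bigl (mem [set Q in D | P \subset Q]%SET)); last by move=> Q; rewrite !inE.
rewrite -[leLHS](big_imset (h := fun Q => Q :\: P) (fun Q => w P * w Q))/=; last first.
  move=> Q1 Q2; rewrite !inE => /andP[_ h1] /andP[_ h2] e.
  by rewrite -(finset.setID Q1 P) -(finset.setID Q2 P) e (finset.setIidPr h1) (finset.setIidPr h2).
rewrite big_mkcond [leRHS]big_mkcond/=; apply: ler_sum => Q _.
case: ifPn => [/imsetP[Q' ]|_].
  rewrite finset.in_set => /andP[QD _] ->.
  by rewrite (small_setsS _ QD)// finset.subsetDl.
case: ifPn => // QD; rewrite mulr_ge0// ltW ?w_gt0//.
Qed.

(** The weights are normalized by [G] at the empty set, so [F k ^+ 2] is nonnegative everywhere and
    equals [G ^+ 2] on the sifted points. Expanding the square gives the main term [n%:R * G];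
    replacing a count of multiples by its density costs at most [|lam P * lam Q|] for each pair. *)
Lemma selberg_sieve :
  #|[set k : 'I_n | [forall p : 'I_z.+1, prime p ==> ~~ (p %| k + c)%N]]%SET|%:R
   <= n%:R / sieve_mass + (\sum_(P in small_sets z) N P * inv_totient P) ^+ 2.
Proof.
set S := [set k | _]%SET; set E := \sum_(P in _) _.
have G0 : 0 < G := sieve_mass_gt0.
pose F (k : 'I_n) := \sum_(P in D) lam P * (setprod P %| k + c)%N%:R.
have FS k : k \in S -> F k = G.
  rewrite inE => /forallP hk; rewrite /F (bigD1 finset.set0) ?small_sets0//=.
  rewrite [X in _ + X]big1 => [|P /andP[PD P0]].
    rewrite addr0 /lam /N /setprod big_set0 dvd1n cards0 expr0 !mul1r mulr1.
    by apply: eq_bigl => Q; rewrite finset.sub0set andbT.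
  have [p pP] := finset.set0Pn _ P0; rewrite dvdn_setprod ?small_prime//.
  case: forall_inP => [/(_ _ pP) hp|_]; last by rewrite mulr0.
  move: (hk p); rewrite hp; have /prime_setP := small_prime PD.
  by move=> /(_ p pP) ->.
have sumF : \sum_(k < n) F k ^+ 2 =
    \sum_(P in D) \sum_(Q in D) lam P * lam Q * (\sum_(k < n) (setprod (P :|: Q) %| k + c)%N)%:R.
  under eq_bigr => k _ do rewrite expr2 big_distrl/=.
  rewrite exchange_big/=; apply: eq_bigr => P PD.
  under eq_bigr => k _ do rewrite big_distrr/=.
  rewrite exchange_big/=; apply: eq_bigr => Q QD.
  rewrite natr_sum big_distrr/=; apply: eq_bigr => k _.
  rewrite mulrACA -natrM mulnb; congr (_ * _%:R); congr nat_of_bool.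
  rewrite !dvdn_setprod ?prime_setU ?small_prime//.
  apply/andP/forall_inP => [[/forall_inP hP /forall_inP hQ] p|h].
    by rewrite inE => /orP[/hP|/hQ].
  by split; apply/forall_inP => p hp; apply: h; rewrite inE hp ?orbT.
have up : \sum_(k < n) F k ^+ 2 <= n%:R * G + E ^+ 2 * G ^+ 2.
  rewrite -[X in n%:R * X]main_term sumF big_distrr/= -lerBlDl -sumrB.
  rewrite (eq_bigr (fun P => \sum_(Q in D) lam P * lam Q *
     ((\sum_(k < n) (setprod (P :|: Q) %| k + c)%N)%:R - n%:R / N (P :|: Q)))); last first.
    move=> P _; rewrite big_distrr/= -sumrB; apply: eq_bigr => Q _.
    by ring.
  rewrite -exprMn expr2 /E !big_distrl/=; apply: ler_sum => P PD.
  rewrite big_distrr/=; apply: ler_sum => Q QD.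
  apply: le_trans (ler_norm _) _; rewrite normrM (normrM (lam P)).
  apply: le_trans (_ : (N P * w P * G) * (N Q * w Q * G) * 1 <= _); last by rewrite mulr1.
  apply: ler_pM => //; first by apply: ler_pM => //; exact: lam_bound.
  by apply: count_dvdn_shift; rewrite setprod_gt0// prime_setU// small_prime.
have lo : #|S|%:R * G ^+ 2 <= \sum_(k < n) F k ^+ 2.
  rewrite (bigID (mem S))/= (eq_bigr (fun=> G ^+ 2)); last by move=> k /FS ->.
  rewrite sumr_const mulr_natl lerDl; apply: sumr_ge0 => k _; exact: sqr_ge0.
rewrite -(ler_pM2r (exprn_gt0 2 G0)) (le_trans lo)// (le_trans up)// mulrDl.
by rewrite lerD2r expr2 mulrA divfK ?gt_eqF.
Qed.

End Selberg.

(** * Size of the sieve constants *)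

Section SieveConstants.
Variable R : realType.

(** The worst case is 2, 3, ..., s + 1, where the product telescopes to s + 1. The induction closes
    because at most [N - 2] integers greater than 1 lie below [N]. *)
Lemma prod_ratio_le (Q : pred nat) (N : nat) : (forall i, Q i -> 1 < i)%N ->
  \prod_(0 <= i < N | Q i) (i%:R / (i%:R - 1)) <= (\sum_(0 <= i < N | Q i) 1)%N%:R + 1 :> R.
Proof.
move=> Q1; have cnt k : (\sum_(0 <= i < k | Q i) 1 <= k - 2)%N.
  elim: k => [|k IH]; first by rewrite big_geq.
  rewrite big_mkcond big_nat_recr//= -big_mkcond/=.
  by case: ifP => [/Q1|]; lia.
elim: N => [|N IH]; first by rewrite !big_geq// add0r.
rewrite big_mkcond [X in X%:R]big_mkcond !big_nat_recr//= -!big_mkcond/=.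
case: ifP => [QN|_]; last by rewrite mulr1 addn0.
have := cnt N; have N1 := Q1 _ QN; move: IH; set s := (\sum_(_ <= _ < _ | _) _)%N.
set r := \prod_(_ <= _ < _ | _) _ => IH hs.
have N0 : 0 < N%:R - 1 :> R by rewrite subr_gt0 ltr1n.
rewrite natrD mulrA ler_pdivrMr//.
apply: le_trans (ler_wpM2r (ler0n _ N) IH) _.
have : s%:R + 2 <= N%:R :> R by rewrite -natrD ler_nat; lia.
by move: N0; clear; set a := s%:R; set b := N%:R; move=> _ h; lra.
Qed.

(** Each summand is d/phi(d), a product of ratios p/(p - 1), hence at most one more than the number
    of prime factors of d. *)
Lemma sieve_error_bound (z : nat) :
  \sum_(P in small_sets z) (setprod P)%:R * inv_totient R P
   <= z%:R * ((trunc_log 2 z)%:R + 1).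
Proof.
apply: le_trans (_ : \sum_(P in small_sets z) ((trunc_log 2 z)%:R + 1) <= _); last first.
  by rewrite sumr_const -[leLHS]mulr_natl ler_wpM2r ?addr_ge0// ler_nat card_small_sets.
apply: ler_sum => P hP; have /small_setsP[/prime_setP pP _] := hP.
apply: le_trans (_ : #|P|%:R + 1 <= _); last by rewrite lerD2r ler_nat card_small_set.
rewrite /setprod /inv_totient natr_prod -big_split/= cardE -sum1_size big_enum/=.
have := @prod_ratio_le (fun i => [exists p in P, i == p :> nat]) z.+1.
rewrite !big_mkord/=; have E (p : 'I_z.+1) : [exists q in P, p == q :> nat] = (p \in P).
  by apply/exists_inP/idP => [[q qP /eqP/ord_inj ->]//|pQ]; exists p.
rewrite (eq_bigl _ _ E) (eq_bigl _ _ E).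
by apply => i /exists_inP[p /pP/prime_gt1 + /eqP ->].
Qed.

Lemma geometric_sum_le (p : R) (N : nat) : 1 < p ->
  \sum_(e < N.+1 | (0 < e)%N) (p ^+ e)^-1 <= (p - 1)^-1.
Proof.
move=> p1; have p0 : 0 < p by apply: lt_trans p1.
have q0 : 0 < p - 1 by rewrite subr_gt0.
rewrite big_mkcond big_ord_recl/= add0r.
have -> : \sum_(i < N) (p ^+ bump 0 i)^-1 = (1 - (p ^+ N)^-1) / (p - 1).
  elim: N => [|N IH]; first by rewrite big_ord0 expr0 invr1 subrr mul0r.
  rewrite big_ord_recr/= IH /bump/= add1n exprS.
  have : p ^+ N != 0 by rewrite expf_neq0// gt_eqF.
  have : p - 1 != 0 by rewrite gt_eqF.
  have : p != 0 by rewrite gt_eqF.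
  by move=> h1 h2 h3; field; rewrite h1 h2 h3.
by rewrite ler_pdivrMr// mulVf ?gt_eqF// lerBlDr lerDl invr_ge0 exprn_ge0// ltW.
Qed.

Definition prime_support (z m : nat) : {set 'I_z.+1} :=
  [set p : 'I_z.+1 | prime p && (p %| m)%N]%SET.

Lemma prod_prime_support (z m : nat) : (0 < m <= z)%N ->
  (\prod_(p in prime_support z m) p ^ logn p m)%N = m.
Proof.
move=> /andP[m0 mz]; rewrite -[RHS](partnT m0) (widen_partn _ mz) big_mkord.
rewrite [LHS]big_mkcond/=; apply: eq_big => [p|p _] //.
rewrite inE; case: ifPn => //; rewrite negb_and => /orP[pn|pn].
  by rewrite lognE (negbTE pn) expn0.
by rewrite lognE (negbTE pn) !andbF expn0.
Qed.

(** Each factor 1/(p - 1) bounds a truncated geometric series in 1/p starting at exponent 1.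
    Multiplying these out yields, among other nonnegative terms, the inverse of every [m] in
    question once, by unique factorization. *)
Lemma sum_inv_same_support (z : nat) (P : {set 'I_z.+1}) : prime_set P ->
  \sum_(m < z.+1 | (0 < m)%N && (prime_support z m == P)) (m%:R)^-1 <= inv_totient R P.
Proof.
move=> /prime_setP pP.
pose F (p e : 'I_z.+1) : R := (p%:R ^+ e)^-1.
apply: le_trans (_ : \prod_(p in P) \sum_(e < z.+1 | (0 < e)%N) F p e <= _); last first.
  apply: ler_prod => p /pP/prime_gt1 p1; rewrite geometric_sum_le ?ltr1n// andbT.
  by apply: sumr_ge0 => e _; rewrite invr_ge0 exprn_ge0.
rewrite (big_distr_big_dep ord0 (mem P) (fun _ (e : 'I_z.+1) => (0 < e)%N))/=.
pose A := [set m : 'I_z.+1 | (0 < m)%N && (prime_support z m == P)]%SET.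
(* Exponents off [P] are [ord0] because [big_distr_big_dep] sums over functions with that default
   outside [P]. *)
pose f (m : 'I_z.+1) : {ffun 'I_z.+1 -> 'I_z.+1} :=
  [ffun p => if p \in P then inord (logn p m) else ord0].
have lz (m p : 'I_z.+1) : m \in A -> p \in P -> (logn p m < z.+1)%N.
  rewrite inE => /andP[m0 _] /pP pp; rewrite ltnS.
  have mz : (m <= z)%N by rewrite -ltnS.
  apply: leq_trans mz; apply: ltnW; apply: leq_trans (ltn_expl _ (prime_gt1 pp)) _.
  by rewrite dvdn_leq// pfactor_dvdnn.
have prodf (m : 'I_z.+1) : m \in A -> (\prod_(p in P) p ^ f m p)%N = m.
  move=> mA; have := mA; rewrite inE => /andP[m0 /eqP mP].
  have mz : (0 < m <= z)%N by rewrite m0 -ltnS /=.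
  rewrite -[RHS](prod_prime_support mz) mP; apply: eq_bigr => p pP'.
  by rewrite ffunE pP' inordK// lz.
have finj : {in A &, injective f}.
  by move=> m m' mA mA' e; apply: ord_inj; rewrite -(prodf m)// e prodf.
rewrite (eq_bigl (mem A)); last by move=> m; rewrite [RHS]inE.
rewrite (eq_bigr (fun m => \prod_(p in P) F p (f m p))); last first.
  move=> m mA; rewrite -{1}(prodf m mA) natr_prod -prodfV.
  by apply: eq_bigr => p _; rewrite natrX.
rewrite -(big_imset (fun g : {ffun 'I_z.+1 -> 'I_z.+1} => \prod_(p in P) F p (g p)) finj)/=.
rewrite big_mkcond [leRHS]big_mkcond/=; apply: ler_sum => g _.
have g0 : 0 <= \prod_(p in P) F p (g p).
  by apply: prodr_ge0 => p _; rewrite invr_ge0 exprn_ge0.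
case: ifPn => [/imsetP[m mA ->]|_]; last by case: ifP.
rewrite ifT//; apply/pfamilyP; split.
  by apply/fintype.subsetP => p; rewrite inE ffunE; case: ifP => //; rewrite eqxx.
move=> p pP'; rewrite unfold_in/= ffunE pP' inordK ?lz//.
move: mA; rewrite inE => /andP[m0 /eqP mP]; move: pP'; rewrite -mP inE => /andP[pp pm].
by rewrite logn_gt0 mem_primes pp m0 pm.
Qed.

(** The integers up to [z] are grouped by their set of prime factors, whose product divides [m] and
    so is at most [z]. *)
Lemma harmonic_le_sieve_mass (z : nat) :
  \sum_(1 <= m < z.+1) (m%:R)^-1 <= sieve_mass R z.
Proof.
have -> : \sum_(1 <= m < z.+1) (m%:R)^-1 = \sum_(m < z.+1 | (0 < m)%N) (m%:R)^-1 :> R.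
  rewrite -(big_mkord (fun m => 0 < m)%N (fun m => m%:R^-1)) [RHS]big_mkcond [RHS]big_ltn//= add0r.
  by apply: eq_big_nat => m /andP[-> _].
rewrite (partition_big (fun m : 'I_z.+1 => prime_support z m) (mem (small_sets z)))/=.
  apply: ler_sum => P /small_setsP[pP _]; exact: sum_inv_same_support.
move=> m m0; apply/small_setsP.
have pP : prime_set (prime_support z m).
  by apply/prime_setP => p; rewrite inE => /andP[].
split=> //; have mz : (m <= z)%N by rewrite -ltnS.
apply: leq_trans mz; rewrite dvdn_leq// dvdn_setprod//.
by apply/forall_inP => p; rewrite inE => /andP[].
Qed.

Lemma ln_succ_diff_le (n : nat) : (0 < n)%N ->
  ln n.+1%:R - ln n%:R <= n%:R^-1 :> R.
Proof.
move=> n0; have n0' : 0 < n%:R :> R by rewrite ltr0n.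
rewrite -ln_div ?posrE ?ltr0n// -natr1 mulrDl divff ?gt_eqF// mul1r.
by apply: le_ln1Dx; rewrite (lt_trans _ (_ : 0 < _)) ?invr_gt0.
Qed.

Lemma ln_succ_diff_ge (n : nat) : (0 < n)%N ->
  n.+1%:R^-1 <= ln n.+1%:R - ln n%:R :> R.
Proof.
move=> n0; have n0' : 0 < n%:R :> R by rewrite ltr0n.
rewrite -opprB lerNr -ln_div ?posrE ?ltr0n//.
have -> : n%:R / n.+1%:R = 1 + (- n.+1%:R^-1) :> R.
  by rewrite -natr1; field; rewrite natr1 pnatr_eq0.
by apply: le_ln1Dx; rewrite ltrN2 invf_lt1 ?ltr0n// ltr1n.
Qed.

Lemma ln_le_harmonic (z : nat) : ln z.+1%:R <= \sum_(1 <= m < z.+1) (m%:R)^-1 :> R.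
Proof.
elim: z => [|z IH]; first by rewrite big_geq// ln1.
rewrite big_nat_recr//=; have := @ln_succ_diff_le z.+1 isT.
by rewrite lerBlDl => /le_trans; apply; rewrite lerD2r.
Qed.

Lemma harmonic_le_ln (z : nat) : \sum_(1 <= m < z.+2) (m%:R)^-1 <= 1 + ln z.+1%:R :> R.
Proof.
elim: z => [|z IH]; first by rewrite big_nat1 ln1 invr1 addr0.
rewrite big_nat_recr//=; have := @ln_succ_diff_ge z.+1 isT.
by rewrite lerBrDl => h; apply: le_trans (lerD IH (lexx _)) _; rewrite -addrA lerD2l.
Qed.

End SieveConstants.

(** * Counting admissible words *)

Lemma sifted_card_le (R : realType) (z n c : nat) : (0 < z)%N ->
  #|[set k : 'I_n | [forall p : 'I_z.+1, prime p ==> ~~ (p %| k + c)%N]]%SET|%:R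
  <= n%:R / ln z.+1%:R + (z%:R * ((trunc_log 2 z)%:R + 1)) ^+ 2 :> R.
Proof.
move=> z0; apply: le_trans (selberg_sieve R n c z0) _.
have ln0 : 0 < ln z.+1%:R :> R by rewrite ln_gt0// ltr1n ltnS.
apply: lerD.
  rewrite ler_wpM2l// lef_pV2 ?posrE ?sieve_mass_gt0//.
  exact: le_trans (ln_le_harmonic R z) (harmonic_le_sieve_mass R z).
rewrite ler_sqr ?nnegrE ?sieve_error_bound ?mulr_ge0 ?addr_ge0//.
apply: sumr_ge0 => P /small_setsP[hP _]; rewrite mulr_ge0// ltW// inv_totient_gt0//.
Qed.

(** The missed class modulo [p] is that of [-c]; a natural [c] keeps the sieve and the Chinese
    remainder theorem within [nat]. *)
Definition admissible_word n (w : n.-tuple bool) : Prop :=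
  forall p : nat, prime p ->
    exists c : nat, forall k : 'I_n, tnth w k -> ~~ (p %| k + c)%N.

Lemma occurs_admissibleP n (w : n.-tuple bool) :
  (exists2 x, admissible_subshift x & occurs_in w x) <-> admissible_word w.
Proof.
split=> [[x xadm [i xw]] p pp|wadm].
  have [r hr] := xadm p pp; exists `|((i - r)%R %% p)%Z|%N => k wk.
  have p0 : p%:Z != 0 by rewrite eqz_nat -lt0n prime_gt0.
  have := hr (i + k%:Z); rewrite /= xw => /(_ wk).
  apply: contra => pk; have : (p %| k%:Z + ((i - r)%R %% p)%Z)%Z.
    by rewrite -[((i - r)%R %% p)%Z]gez0_abs ?modz_ge0// -PoszD.
  rewrite eqz_mod_dvd => h.
  have -> : i + k%:Z - r = ((i - r) %/ p)%Z * p%:Z + (k%:Z + ((i - r)%R %% p)%Z).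
    by rewrite [k%:Z + _]addrC addrA -divz_eq addrAC.
  by apply: rpredD => //; apply: dvdz_mull.
(* The word is padded with zeros, which adds nothing to its support. *)
exists (fun i : int => if i is Posz k then nth false w k else false); last first.
  by exists 0 => k; rewrite add0r (tnth_nth false).
move=> p pp; have [c hc] := wadm p pp; exists (- c%:Z) => -[k|k]//= wk.
have kn : (k < n)%N.
  by rewrite ltnNge; apply/negP => nk; move: wk; rewrite nth_default// size_tuple.
have := hc (Ordinal kn); rewrite (tnth_nth false) => /(_ wk).
by apply: contra; rewrite eqz_mod_dvd opprK -PoszD.
Qed.

Definition words_on n (S : {set 'I_n}) : {set n.-tuple bool} :=
  [set w : n.-tuple bool | [forall k, tnth w k ==> (k \in S)]]%SET.

Lemma card_words_on n (S : {set 'I_n}) : #|words_on S| = (2 ^ #|S|)%N.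
Proof.
pose f (T : {set 'I_n}) : n.-tuple bool := [tuple k \in T | k < n].
have fE T k : tnth (f T) k = (k \in T) by rewrite tnth_mktuple.
have -> : words_on S = f @: powerset S.
  apply/finset.setP => w; rewrite inE; apply/forallP/finset.imsetP => [h|[T + -> k]].
    exists [set k | tnth w k]%SET.
      by rewrite powersetE; apply/fintype.subsetP => k; rewrite inE; exact/implyP.
    by apply: eq_from_tnth => k; rewrite fE inE.
  by rewrite powersetE fE => /fintype.subsetP h; apply/implyP; exact: h.
rewrite card_imset ?card_powerset// => T T' e.
by apply/finset.setP => k; rewrite -!fE e.
Qed.

(** The modulus [z!] is divisible by every prime up to [z] and coprime to [z.+1] when that is prime,
    so each induction step combines only two moduli. *)
Lemma chinese_fact (z : nat) (r : nat -> nat) :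
  exists c : nat, forall p, prime p -> (p <= z)%N -> c = r p %[mod p].
Proof.
elim: z => [|z [c IH]]; first by exists 0%N => p /prime_gt0; lia.
have [pz|npz] := boolP (prime z.+1); last first.
  exists c => p pp; rewrite leq_eqVlt => /orP[/eqP pz|]; last exact: IH.
  by rewrite -pz pp in npz.
have co : coprime z`! z.+1.
  rewrite coprime_sym prime_coprime// fact_prod Euclid_dvd_prod// big_has.
  by apply/hasPn => i; rewrite mem_index_iota => /andP[i0 iz]; rewrite gtnNdvd.
exists (chinese z`! z.+1 c (r z.+1)) => p pp.
rewrite leq_eqVlt => /orP[/eqP ->|]; first exact: chinese_modr.
rewrite ltnS => le_pz.
rewrite -IH// -(@modn_dvdm z`! _ p); last by rewrite dvdn_fact ?prime_gt0.
by rewrite chinese_modl// modn_dvdm// dvdn_fact ?prime_gt0.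
Qed.

Lemma cpx_admissible_le (z n M : nat) :
  (forall c : nat,
     #|[set k : 'I_n | [forall p : 'I_z.+1, prime p ==> ~~ (p %| k + c)%N]]%SET| <= M)%N ->
  (cpx admissible_subshift n <= z`! * 2 ^ M)%N.
Proof.
move=> hM.
pose S (c : nat) := [set k : 'I_n | [forall p : 'I_z.+1, prime p ==> ~~ (p %| k + c)%N]]%SET.
apply: (@leq_trans #|\bigcup_(c < z`!) words_on (S c)|); last first.
  apply: leq_trans (mathcomp.classical.unstable.card_big_setU _ _ _) _.
  apply: (@leq_trans (\sum_(c < z`!) 2 ^ M)); last by rewrite sum_nat_const card_ord.
  by apply: leq_sum => c _; rewrite card_words_on leq_exp2l// hM.
apply: fintype.subset_leq_card; apply/fintype.subsetP => w; rewrite inE => /asboolP/occurs_admissibleP wadm.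
have /choice [r hr] : forall p, exists c, prime p -> forall k : 'I_n, tnth w k -> ~~ (p %| k + c)%N.
  move=> p; have [/wadm[c hc]|np] := boolP (prime p); first by exists c.
  by exists 0%N.
have [c hc] := chinese_fact z r.
have cz : (c %% z`! < z`!)%N by rewrite ltn_mod fact_gt0.
apply/finset.bigcupP; exists (Ordinal cz) => //; rewrite inE; apply/forallP => k.
apply/implyP => wk; rewrite inE; apply/forallP => p; apply/implyP => pp.
have pz : (p <= z)%N by rewrite -ltnS.
have := hr p pp k wk; rewrite /dvdn -modnDmr -(hc p pp pz) modnDmr/=.
by rewrite -[in X in _ -> X]modnDmr modn_dvdm ?modnDmr// dvdn_fact ?prime_gt0.
Qed.

Lemma cpx_admissible_ge n (S : {set 'I_n}) :
  (forall p, prime p -> exists c : nat, forall k, k \in S -> ~~ (p %| k + c)%N) ->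
  (2 ^ #|S| <= cpx admissible_subshift n)%N.
Proof.
move=> hS; rewrite -card_words_on; apply: fintype.subset_leq_card; apply/fintype.subsetP => w.
rewrite inE => /forallP wS; rewrite inE; apply/asboolP/occurs_admissibleP => p /hS[c hc].
by exists c => k wk; apply: hc; move: (wS k); rewrite wk.
Qed.

(** * Words of the primes *)

Section Subshifts.
Local Open Scope classical_set_scope.

(** Prescribing finitely many coordinates is an open condition, so a word of a limit point already
    occurs in some shift of [y]. *)
Lemma occurs_orbit_closureP n (w : n.-tuple bool) (y : bisequence) :
  (exists2 x, orbit_closure y x & occurs_in w x) <-> occurs_in w y.
Proof.
split=> [[x yx [i xw]]|[i yw]]; last first.
  exists y; last by exists i.
  by apply: subset_closure; exists 0 => //; apply/funext => m; exact: (congr1 y (addr0 m)).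
have nb : nbhs x [set u : bisequence | forall k : 'I_n, u (i + k%:Z) = x (i + k%:Z)].
  have FF : Filter (nbhs x) by apply: nbhs_filter.
  refine (@filter_forall _ _ (fun (k : 'I_n) (u : bisequence) => u (i + k%:Z) = x (i + k%:Z)) (nbhs x) FF _) => k.
  have : nbhs (x (i + k%:Z)) [set x (i + k%:Z)] by exact: discrete_set1.
  exact: (@proj_continuous int (fun=> bool) (i + k%:Z) x).
have [_ [[j _ <-] /= h]] := yx _ nb.
exists (i + j) => k; have := h k; rewrite /shift xw => <-.
by rewrite addrAC.
Qed.

Lemma sym_primesE (i : int) :
  sym_indicator [set p | prime p] i = prime `|i|%N.
Proof.
apply/idP/idP => [/asboolP[p pp [->|->]]|pi].
- by rewrite absz_nat.
- by rewrite abszN absz_nat.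
apply/asboolP; exists `|i|%N => //; lia.
Qed.

(** The words starting in [[-2n, 2n]] are listed by [f]. Further out all positions exceed [n] in
    absolute value, so no prime there is divisible by a prime [p <= n]. *)
Lemma cpx_primes_le n :
  (cpx primes_subshift n <= cpx admissible_subshift n + (4 * n).+1)%N.
Proof.
pose y := sym_indicator [set p | prime p].
pose f (c : 'I_(4 * n).+1) : n.-tuple bool :=
  [tuple y (c%:Z - (2 * n)%:Z + (k : 'I_n)%:Z) | k < n].
rewrite -[X in (_ <= _ + X)%N]card_ord -(cardsT 'I_(4 * n).+1).
apply: leq_trans (leq_add (leqnn _) (leq_imset_card f _)).
apply: leq_trans (leq_card_setU _ _).
apply: fintype.subset_leq_card; apply/fintype.subsetP => w.
rewrite inE => /asboolP/occurs_orbit_closureP [i yw]; rewrite inE; apply/orP.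
have [lt2n|ge2n] := leqP `|i|%N (2 * n).
  right; have ci : (`|(i + (2 * n)%:Z)%R|%N < (4 * n).+1)%N by lia.
  apply/finset.imsetP; exists (Ordinal ci) => //; apply: eq_from_tnth => k.
  rewrite tnth_mktuple -yw /y/=; congr (sym_indicator _ _); lia.
left; rewrite inE; apply/asboolP/occurs_admissibleP => p pp.
have [pn|np] := leqP p n; last first.
  (* For [p > n] the numbers [k + 1] stay in [[1, n]] and avoid the class of 0. *)
  by exists 1%N => k _; rewrite gtnNdvd ?addn1// (leq_ltn_trans _ np).
have p0 : p%:Z != 0 by rewrite eqz_nat -lt0n prime_gt0.
exists `|(i %% p)%Z|%N => k wk; apply/negP => pk.
have := yw k; rewrite sym_primesE wk => ik.
have : (p %| `|(i + k%:Z)%R|)%N.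
  change (p%:Z %| i + k%:Z)%Z.
  have : (p%:Z %| k%:Z + (i %% p)%Z)%Z.
    by rewrite -[(i %% p)%Z]gez0_abs ?modz_ge0// -PoszD.
  rewrite {2}(divz_eq i p) -addrA [in X in _ -> X]addrC [(i %% p)%Z + _]addrC => h.
  by apply: rpredD => //; apply: dvdz_mull.
rewrite dvdn_prime2// => /eqP e; have := ltn_ord k; lia.
Qed.

(** * Consequences of the Hardy-Littlewood conjecture *)

Section HardyLittlewood.
Variable R : realType.
Hypothesis HL : hardy_littlewood R.

(** The inequality [u <= expR u] at [u = y / m.+1%:R], raised to the power [m.+1]. *)
Lemma pow_le_expR (m : nat) (y : R) : 0 <= y -> y ^+ m.+1 <= m.+1%:R ^+ m.+1 * expR y.
Proof.
move=> y0; have m0 : 0 < m.+1%:R :> R by rewrite ltr0n.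
rewrite -ler_pdivrMl ?exprn_gt0// mulrC -expr_div_n.
have -> : expR y = expR (y / m.+1%:R) ^+ m.+1.
  by rewrite -expRM_natr divfK// gt_eqF.
rewrite lerXn2r ?nnegrE ?expR_ge0 ?divr_ge0//.
by apply: le_trans (expR_ge1Dx _); rewrite lerDr.
Qed.

Lemma cvg_invr_ln : ((ln X)^-1 : R) @[X --> +oo] --> (0 : R).
Proof.
apply/cvgrPdist_le => e e0; near=> X.
have X1 : expR e^-1 <= X by near: X; apply: nbhs_pinfty_ge; rewrite num_real.
have lX : e^-1 <= ln X by rewrite -[leLHS]expRK ler_ln ?posrE ?expR_gt0// (lt_le_trans _ X1) ?expR_gt0.
have l0 : 0 < ln X by rewrite (lt_le_trans _ lX)// invr_gt0.
by rewrite sub0r normrN gtr0_norm ?invr_gt0// -[leRHS]invrK lef_pV2 ?posrE// invr_gt0.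
Unshelve. all: by end_near. Qed.

Lemma cvg_ln_pow_div (k : nat) : (ln X ^+ k / X : R) @[X --> +oo] --> (0 : R).
Proof.
apply: (@squeeze_cvgr _ _ _ _ (cst 0) (fun X => k.+1%:R ^+ k.+1 * (ln X)^-1)); first last.
- by rewrite -[X in _ --> X](mulr0 (k.+1%:R ^+ k.+1 : R)); apply: cvgM; [exact: cvg_cst|exact: cvg_invr_ln].
- exact: cvg_cst.
near=> X.
have X1 : 1 < X by near: X; apply: nbhs_pinfty_gt; rewrite num_real.
have X0 : 0 < X by apply: lt_trans X1.
have l0 : 0 < ln X by rewrite ln_gt0.
apply/andP; split=> /=; first by rewrite divr_ge0 ?exprn_ge0 ?ltW.
rewrite ler_pdivrMr// mulrAC ler_pdivlMr// -exprSr.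
by have := pow_le_expR k (ltW l0); rewrite lnK ?posrE.
Unshelve. all: by end_near. Qed.

(** Positivity of the singular series comes from the conjecture itself: as division by 0 gives 0, a
    zero series would make the ratio constantly 0, while it tends to 1. *)
Lemma cvg_tuple_count (k : nat) (h : k.-tuple int) :
  (0 < k)%N -> uniq h -> admissible [set` h] ->
  0 < singular_series R h /\
  ((tuple_count h X)%:R / (X / ln X ^+ k) @[X --> +oo] --> singular_series R h).
Proof.
move=> k0 hu hadm; have := HL k0 hu hadm; set s := singular_series R h => lim1.
have s0 : s != 0.
  apply/eqP => s0; have /eqP : (0 : R) = 1.
    apply: (cvg_unique (@Rhausdorff R)) lim1; rewrite s0; apply: cvg_near_cst.
    by apply: nearW => X; rewrite mul0r invr0 mulr0.
  by rewrite eq_sym oner_eq0.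
have lims : (tuple_count h X)%:R / (X / ln X ^+ k) @[X --> +oo] --> s.
  have -> : (fun X : R => (tuple_count h X)%:R / (X / ln X ^+ k)) =
     (fun X => (tuple_count h X)%:R / (s * (X / ln X ^+ k)) * s).
    by apply/funext => X; rewrite (invfM s) mulrA (mulrAC _ s^-1) divfK.
  by rewrite -[X in _ --> X]mul1r; apply: cvgM => //; exact: cvg_cst.
split=> //; rewrite lt_def s0/=; apply: (cvgr_to_ge lims); near=> X.
have X1 : 1 < X by near: X; apply: nbhs_pinfty_gt; rewrite num_real.
by rewrite divr_ge0// divr_ge0 ?exprn_ge0 ?ln_ge0 ?ltW// (lt_trans _ X1).
Unshelve. all: by end_near. Qed.

(** If every class modulo [p] is hit, some [m + a] is a multiple of [p]; being prime it equals [p],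
    so [m <= p]. *)
Lemma tuple_count_not_admissible (k : nat) (h : k.-tuple int) :
  (forall a, a \in h -> 0 <= a) -> ~ admissible [set` h] ->
  exists p : nat, forall X : R, (tuple_count h X <= p)%N.
Proof.
move=> h0 /existsNP[p /not_implyP[pp hp]]; exists p => X.
rewrite /tuple_count -size_filter -[leqRHS](size_iota 1 p); apply: uniq_leq_size.
  by rewrite filter_uniq// iota_uniq.
move=> m; rewrite mem_filter mem_iota => /andP[/allP hm /andP[m1 _]].
move/forallNP: hp => /(_ (- m%:Z))/existsNP[a /not_implyP[/= ah /negP]].
rewrite negbK eqz_mod_dvd opprK => pam.
have := hm a ah; have := h0 a ah; move: pam; case: a ah => // a _ pam _.
rewrite -PoszD => pma; have : (p %| m + a)%N by rewrite addnC.
by rewrite dvdn_prime2// => /eqP e; rewrite mem_iota m1 add1n ltnS e leq_addr.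
Qed.

Lemma occurs_primes n (w : n.-tuple bool) (k0 : 'I_n) :
  tnth w k0 -> admissible_word w ->
  occurs_in w (sym_indicator [set p | prime p]).
Proof.
move=> wk0 wadm; apply: contrapT => wocc.
pose hs := [seq k%:Z | k : 'I_n <- [seq k <- enum 'I_n | tnth w k]].
have hsP a : reflect (exists2 k : 'I_n, tnth w k & a = k%:Z) (a \in hs).
  apply: (iffP mapP) => [[k + ->]|[k wk ->]].
    by rewrite mem_filter => /andP[wk _]; exists k.
  by exists k => //; rewrite mem_filter wk mem_enum.
have hs_uniq : uniq hs.
  by rewrite map_inj_uniq ?filter_uniq -?enumT ?enum_uniq// => a b [] /ord_inj.
pose B := [set k : 'I_n | ~~ tnth w k]%SET.
pose bs (b : 'I_n) := b%:Z :: hs.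
(* As [w] occurs nowhere, each [m] with primes at the whole support also has a prime at some
   position [b] where [w] is 0. *)
have count_le (X : R) :
    (tuple_count (in_tuple hs) X <= \sum_(b in B) tuple_count (in_tuple (bs b)) X)%N.
  rewrite /tuple_count.
  rewrite -sum1_count big_mkcond/=.
  under [leqRHS]eq_bigr do rewrite -sum1_count big_mkcond/=.
  rewrite exchange_big/= big_seq [leqRHS]big_seq; apply: leq_sum => m.
  rewrite mem_iota => /andP[m1 _]; case: ifPn => // hm.
  have [b bB mb] : exists2 b, b \in B & prime_int (m%:Z + b%:Z).
    apply: contrapT => nb; apply: wocc; exists m%:Z => k; rewrite sym_primesE.
    case wk : (tnth w k).
      by move/allP: hm => /(_ k%:Z); apply; apply/hsP; exists k.
    apply/negP => pk; apply: nb; exists k; first by rewrite inE wk.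
    by [].
  rewrite (bigD1 b) //=; apply: leq_trans (leq_addr _ _).
  by rewrite andbT ifT.
pose Y (X : R) := X / ln X ^+ size hs.
have hs_size : (0 < size hs)%N.
  by rewrite -has_predT; apply/hasP; exists k0%:Z => //; apply/hsP; exists k0.
have [s0 lims] : 0 < singular_series R (in_tuple hs) /\
    ((tuple_count (in_tuple hs) X)%:R / Y X @[X --> +oo] --> singular_series R (in_tuple hs)).
  apply: cvg_tuple_count => // p pp; have [c hc] := wadm p pp.
  exists (- c%:Z) => a /= /hsP[k wk ->]; rewrite eqz_mod_dvd opprK.
  exact: hc.
(* If adding [b] keeps the tuple admissible, its count is smaller by a factor [ln X]; otherwise its
   count is bounded. *)
have limb b : b \in B ->
    ((tuple_count (in_tuple (bs b)) X)%:R / Y X @[X --> +oo] --> (0 : R)).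
  rewrite inE => wb.
  have [badm|nadm] := pselect (admissible [set` in_tuple (bs b)]).
    have bu : uniq (in_tuple (bs b)).
      rewrite /= hs_uniq andbT; apply/negP => /hsP[k wk [/ord_inj e]].
      by rewrite e wk in wb.
    have [_ lb] := cvg_tuple_count (ltn0Sn _) bu badm.
    have lb0 := cvgM lb cvg_invr_ln; rewrite mulr0 in lb0.
    have -> : (fun X : R => (tuple_count (in_tuple (bs b)) X)%:R / Y X) =
        (fun X => (tuple_count (in_tuple (bs b)) X)%:R / (X / ln X ^+ size (bs b)) * (ln X)^-1).
      apply/funext => X; rewrite /Y /= exprS !invfM !invrK -!mulrA; congr (_ * (_ * _)).
      (* The equality is one of functions on all of [R], so [ln X = 0] must be checked; both sides
         then vanish because [hs] is nonempty. *)
      have [->|L0] := eqVneq (ln X) 0; last by rewrite mulrCA divff ?mulr1.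
      by rewrite expr0n gtn_eqF// !mul0r.
    exact: lb0.
  have [|p hp] := tuple_count_not_admissible _ nadm.
    by move=> a; rewrite inE => /orP[/eqP ->|/hsP[k _ ->]].
  apply: (@squeeze_cvgr _ _ _ _ (cst 0) (fun X => p%:R * (ln X ^+ size hs / X))); first last.
  - by rewrite -[X in _ --> X](mulr0 (p%:R : R)); apply: cvgM; [exact: cvg_cst|exact: cvg_ln_pow_div].
  - exact: cvg_cst.
  near=> X; have X1 : 1 < X by near: X; apply: nbhs_pinfty_gt; rewrite num_real.
  have Y0 : 0 <= (Y X)^-1.
    by rewrite invr_ge0 divr_ge0 ?exprn_ge0 ?ln_ge0 ?ltW// (lt_trans _ X1).
  by rewrite mulr_ge0//= -[ln X ^+ _ / X]invf_div ler_wpM2r// ler_nat.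
have limB : (\sum_(b in B) (tuple_count (in_tuple (bs b)) X)%:R / Y X @[X --> +oo] --> (0 : R)).
  rewrite -[X in _ --> X](_ : \sum_(b in B) 0 = 0 :> R); last by rewrite big1.
  by apply: cvg_big => //; exact: add_continuous.
have : singular_series R (in_tuple hs) <= 0.
  apply: ler_cvg_to lims limB _; near=> X.
  have X1 : 1 < X by near: X; apply: nbhs_pinfty_gt; rewrite num_real.
  rewrite -big_distrl/= ler_wpM2r// -?natr_sum ?ler_nat//.
  by rewrite invr_ge0 divr_ge0 ?exprn_ge0 ?ln_ge0 ?ltW// (lt_trans _ X1).
by rewrite leNgt s0.
Unshelve. all: by end_near. Qed.

(** The extra 1 accounts for the zero word, whose empty support gives no tuple to apply the
    conjecture to. *)
Lemma cpx_admissible_le_primes n :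
  (cpx admissible_subshift n <= cpx primes_subshift n + 1)%N.
Proof.
rewrite -(cards1 [tuple false | _ < n]); apply: leq_trans (leq_card_setU _ _).
apply: fintype.subset_leq_card; apply/fintype.subsetP => w.
rewrite inE => /asboolP/occurs_admissibleP wadm; rewrite inE; apply/orP.
have [[k wk]|w0] := pselect (exists k, tnth w k); [left|right].
  by rewrite inE; apply/asboolP/occurs_orbit_closureP; exact: occurs_primes wk wadm.
rewrite inE; apply/eqP/eq_from_tnth => k; rewrite tnth_mktuple.
by apply/negP => wk; apply: w0; exists k.
Qed.

End HardyLittlewood.
End Subshifts.

(** * Mertens' theorem and prime-rich windows *)

Section Mertens.
Variable R : realType.

(** Chebyshev's theta function, followed by the sum of Mertens' first theorem. *)
Definition primes_log_sum (N : nat) : R := \sum_(0 <= p < N.+1 | prime p) ln p%:R.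
Definition primes_log_ratio_sum (N : nat) : R :=
  \sum_(0 <= p < N.+1 | prime p) ln p%:R / p%:R.

Lemma ln_logn (N m : nat) : (0 < m <= N)%N ->
  ln m%:R = \sum_(0 <= p < N.+1) (logn p m)%:R * ln p%:R :> R.
Proof.
move=> /andP[m0 mN]; rewrite -{1}(partnT m0) (widen_partn _ mN) big_mkcond/=.
rewrite natr_prod; elim: N.+1 => [|k IH]; first by rewrite !big_geq// ln1.
have pos i : 0 < (i ^ logn i m)%:R :> R.
  by rewrite ltr0n expn_gt0; case: i => //=; rewrite lognE.
rewrite !big_nat_recr//= lnM ?posrE ?prodr_gt0// IH; congr (_ + _).
rewrite natrX; case: k {IH} => [|k]; first by rewrite lognE/= expr0 ln1 mul0r.
by rewrite lnXn ?ltr0n// mulr_natl.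
Qed.

Lemma ln_fact_logn (N n : nat) : (n <= N)%N ->
  ln n`!%:R = \sum_(0 <= p < N.+1) (logn p n`!)%:R * ln p%:R :> R.
Proof.
elim: n => [|n IH] nN.
  by rewrite fact0 ln1 big1// => p _; rewrite logn1 mul0r.
rewrite factS natrM lnM ?posrE ?ltr0n ?fact_gt0// IH ?(ltnW nN)// (@ln_logn N n.+1)//.
rewrite -big_split/=; apply: eq_bigr => p _.
by rewrite lognM ?fact_gt0// natrD mulrDl.
Qed.

Lemma ln_fact_primes (N : nat) :
  ln N`!%:R = \sum_(0 <= p < N.+1 | prime p) (logn p N`!)%:R * ln p%:R :> R.
Proof.
rewrite (@ln_fact_logn N)// [RHS]big_mkcond; apply: eq_bigr => p _.
by case: ifPn => // np; rewrite lognE (negbTE np) mul0r.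
Qed.

Lemma ln_fact_ge (N : nat) : N%:R * ln N%:R - N%:R <= ln N`!%:R :> R.
Proof.
elim: N => [|N IH]; first by rewrite fact0 ln1 mul0r subr0.
rewrite factS natrM lnM ?posrE ?ltr0n ?fact_gt0// -lerBlDl.
apply: le_trans IH; case: N => [|N]; first by rewrite ln1 mul0r; lra.
have := @ln_succ_diff_le R N.+1 isT.
have N0 : 0 < N.+1%:R :> R by rewrite ltr0n.
rewrite -(ler_pM2l N0) divff ?gt_eqF// -[N.+2%:R]natr1.
move: N0; set a := N.+1%:R; set b := ln a; set d := ln _; nra.
Qed.

Lemma ln_fact_le (N : nat) : ln N`!%:R <= N%:R * ln N%:R :> R.
Proof.
have [->|N0] := posnP N; first by rewrite fact0 ln1 mul0r.
rewrite mulr_natl -lnXn ?ltr0n// -natrX ler_ln ?posrE ?ltr0n ?fact_gt0 ?expn_gt0 ?N0//.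
rewrite ler_nat {N0}; elim: N => // N IH; rewrite factS expnS leq_mul//.
by apply: leq_trans IH _; case: N => // N; rewrite leq_exp2r.
Qed.

(** The term outside the sum majorizes the tail of the series: it makes the left side nonincreasing
    in [N], starting from 2. *)
Lemma sum_ln_telescope (N : nat) :
  \sum_(2 <= m < N.+2) ln m%:R / (m%:R * (m%:R - 1)) + (ln N.+1%:R + 2) / N.+1%:R <= 2 :> R.
Proof.
elim: N => [|N IH]; first by rewrite big_geq// ln1; lra.
rewrite big_nat_recr//=; apply: le_trans IH; rewrite -addrA lerD2l.
have a0 : 0 < N.+1%:R :> R by rewrite ltr0n.
have a1 : 1 <= N.+1%:R :> R by rewrite ler1n.
have -> : N.+2%:R = N.+1%:R + 1 :> R by rewrite natr1.
have := @ln_succ_diff_le R N.+1 isT; rewrite -[N.+2%:R]natr1.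
have : 0 <= ln (N.+1%:R : R) by rewrite ln_ge0.
move: a0 a1; set a := N.+1%:R; set x := ln a; set y := ln (a + 1) => a0 a1 x0.
rewrite -(ler_pM2l a0) mulrBr divff ?gt_eqF// => h.
have -> : y / ((a + 1) * (a + 1 - 1)) + (y + 2) / (a + 1) =
   (y + a * (y + 2)) / (a * (a + 1)).
  by field; rewrite !gt_eqF// ltr_wpDr.
have -> : (x + 2) / a = (x + 2) * (a + 1) / (a * (a + 1)).
  by field; rewrite !gt_eqF// ltr_wpDr.
rewrite ler_pM2r ?invr_gt0 ?mulr_gt0 ?ltr_wpDr//.
have yx : y - x <= 1 by nra.
nra.
Qed.

(** Legendre's formula bounds [ln N!] by [N] times the sum of ln p / (p - 1). Passing to ln p / p
    costs at most 2, and Stirling's lower bound for [ln N!] costs 1. *)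
Lemma primes_log_ratio_sum_ge (N : nat) : (0 < N)%N ->
  ln N%:R - 3 <= primes_log_ratio_sum N.
Proof.
move=> N0; have N0' : 0 < N%:R :> R by rewrite ltr0n.
have h1 : ln N`!%:R <= N%:R * \sum_(0 <= p < N.+1 | prime p) ln p%:R / (p%:R - 1) :> R.
  rewrite ln_fact_primes big_distrr/=; apply: ler_sum => p pp.
  rewrite mulrCA mulrC ler_wpM2l ?ln_ge0 ?ler1n ?prime_gt0//.
  have p1 : 1 < p%:R :> R by rewrite ltr1n prime_gt1.
  apply: le_trans (_ : N%:R * (\sum_(e < N.+1 | (0 < e)%N) (p%:R ^+ e)^-1) <= _); last first.
    by rewrite ler_wpM2l// geometric_sum_le.
  rewrite logn_fact// natr_sum big_distrr/=.
  rewrite -(big_mkord (fun e => 0 < e)%N (fun e => N%:R * (p%:R ^+ e)^-1)).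
  rewrite [leRHS]big_mkcond [leRHS]big_ltn//= add0r; apply: ler_sum_nat => k /andP[k0 _].
  rewrite k0 ler_pdivlMr ?exprn_gt0 ?(lt_trans _ p1)// -natrX -natrM ler_nat.
  exact: leq_trunc_div.
have h2 : \sum_(0 <= p < N.+1 | prime p) ln p%:R / (p%:R - 1)
    = primes_log_ratio_sum N + \sum_(0 <= p < N.+1 | prime p) ln p%:R / (p%:R * (p%:R - 1)) :> R.
  rewrite -big_split/=; apply: eq_bigr => p /prime_gt1 p1; field.
  by rewrite subr_eq0 pnatr_eq1 pnatr_eq0; case: p p1 => [|[]].
have h3 : \sum_(0 <= p < N.+1 | prime p) ln p%:R / (p%:R * (p%:R - 1)) <= 2 :> R.
  apply: le_trans (sum_ln_telescope N); apply: le_trans (_ : \sum_(2 <= m < N.+2) ln m%:R / (m%:R * (m%:R - 1)) <= _).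
    rewrite big_mkcond; apply: le_trans (_ : \sum_(2 <= p < N.+1) ln p%:R / (p%:R * (p%:R - 1)) <= _).
      rewrite big_ltn//= add0r; case: N {N0 N0' h1 h2} => [|N]; first by rewrite !big_geq.
      rewrite big_ltn//= add0r; apply: ler_sum_nat => p /andP[p2 _]; case: ifP => // _.
      by rewrite divr_ge0 ?mulr_ge0 ?ln_ge0 ?subr_ge0 ?ler1n// (leq_trans _ p2).
    rewrite [leRHS]big_nat_recr//= lerDl.
    by rewrite divr_ge0 ?mulr_ge0 ?ln_ge0 ?subr_ge0 ?ler1n.
  by rewrite lerDl divr_ge0// addr_ge0 ?ln_ge0 ?ler1n.
have := le_trans (ln_fact_ge N) h1; rewrite h2 -[X in _ - X]mulr1 -mulrBr ler_pM2l//.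
move: h3; set s := \sum_(_ <= _ < _ | _) _; lra.
Qed.

(** Erdős's induction: for an odd prime 2m + 1, the primes in (m + 1, 2m + 1] all divide the
    binomial coefficient C(2m + 1, m). *)
Lemma primorial_le (N : nat) : (\prod_(0 <= p < N.+1 | prime p) p <= 4 ^ N)%N.
Proof.
elim/ltn_ind: N => N IH.
case: N IH => [|[|N]] IH; rewrite ?[X in (X <= _)%N]big_mkcond/=.
- by rewrite big_nat1.
- by rewrite !big_nat_recr//= big_geq.
rewrite big_nat_recr//= -big_mkcond/=; case: ifPn => [pN|_]; last first.
  by rewrite muln1; apply: leq_trans (IH N.+1 _) _; rewrite ?leq_exp2l.
have [->|N0] := posnP N; first by rewrite big_mkcond !big_nat_recr//= big_geq.
have oN : odd N.+2 by have := @even_prime _ pN => -[] //; lia.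
pose m := (N.+1)./2; have Nm : N.+2 = (2 * m).+1 by rewrite /m; lia.
have -> : (\prod_(0 <= p < N.+2 | prime p) p * N.+2 = \prod_(0 <= p < N.+3 | prime p) p)%N.
  by rewrite [RHS]big_mkcond [RHS]big_nat_recr//= pN -big_mkcond.
rewrite Nm (@big_cat_nat _ _ _ m.+2)//=; last by lia.
have -> : (4 ^ (2 * m).+1 = 4 ^ m.+1 * 4 ^ m)%N by rewrite -expnD; congr (_ ^ _)%N; lia.
apply: leq_mul; first by apply: IH; lia.
(* This coefficient appears twice in the expansion of (1 + 1)^(2m + 1). *)
have bin_le : ('C((2 * m).+1, m) <= 4 ^ m)%N.
  have : ('C((2 * m).+1, m) + 'C((2 * m).+1, m.+1) <= 2 ^ (2 * m).+1)%N.
    rewrite -[X in (_ <= X ^ _)%N]/(1 + 1)%N expnDn.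
    under eq_bigr do rewrite !exp1n !muln1.
    have lt1 : (m < (2 * m).+2)%N by lia.
    have lt2 : (m.+1 < (2 * m).+2)%N by lia.
    rewrite (bigD1 (Ordinal lt1))//= (bigD1 (Ordinal lt2))/=; last by rewrite -val_eqE/=; lia.
    by rewrite addnA leq_addr.
  rewrite -(@bin_sub _ m.+1); last by lia.
  have -> : ((2 * m).+1 - m.+1 = m)%N by lia.
  by rewrite addnn -mul2n expnS expnM leq_pmul2l.
apply: leq_trans bin_le; rewrite dvdn_leq ?bin_gt0//; first by lia.
rewrite -big_filter; apply: prod_primes_dvdn.
- by rewrite filter_uniq// iota_uniq.
- by move=> p; rewrite mem_filter => /andP[].
move=> p; rewrite mem_filter mem_index_iota => /and3P[pp mp pm].
have ndvd k : (k <= m.+1)%N -> ~~ (p %| k`!)%N.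
  move=> km; rewrite fact_prod Euclid_dvd_prod// big_has.
  by apply/hasPn => i; rewrite mem_index_iota => /andP[i0 iz]; rewrite gtnNdvd//; lia.
have : (p %| (2 * m).+1`!)%N by rewrite dvdn_fact ?prime_gt0.
have mm : (m <= (2 * m).+1)%N by lia.
rewrite -(bin_fact mm) !Euclid_dvdM//.
have -> : ((2 * m).+1 - m = m.+1)%N by lia.
by rewrite (negbTE (ndvd m _))// (negbTE (ndvd m.+1 _))// !orbF.
Qed.

Lemma primes_log_sum_le (N : nat) : primes_log_sum N <= N%:R * ln 4.
Proof.
have -> : primes_log_sum N = ln (\prod_(0 <= p < N.+1 | prime p) p)%N%:R.
  rewrite /primes_log_sum natr_prod.
  elim: N.+1 => [|k IH]; first by rewrite !big_geq// ln1.
  rewrite big_mkcond [X in ln X]big_mkcond !big_nat_recr//= -!big_mkcond/= IH.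
  case: ifP => pk; last by rewrite addr0 mulr1.
  by rewrite lnM ?posrE ?prodr_gt0 ?ltr0n ?prime_gt0// => i /prime_gt0; rewrite ltr0n.
rewrite mulr_natl -lnXn// ler_ln ?posrE ?exprn_gt0//.
  by rewrite -natrX ler_nat primorial_le.
by rewrite ltr0n prodn_cond_gt0// => p /prime_gt0.
Qed.

(** Legendre's formula with [N / p <= N %/ p + 1] loses at most theta(N), which is at most
    [N * ln 4]. *)
Lemma primes_log_ratio_sum_le (N : nat) : (0 < N)%N ->
  primes_log_ratio_sum N <= ln N%:R + ln 4.
Proof.
move=> N0; have N0' : 0 < N%:R :> R by rewrite ltr0n.
have h : N%:R * primes_log_ratio_sum N - primes_log_sum N <= ln N`!%:R.
  rewrite ln_fact_primes /primes_log_ratio_sum /primes_log_sum big_distrr/= -sumrB.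
  apply: ler_sum => p pp; rewrite mulrCA mulrC -[X in _ - X]mul1r -mulrBl.
  rewrite ler_wpM2r ?ln_ge0 ?ler1n ?prime_gt0// lerBlDr.
  rewrite ler_pdivrMr ?ltr0n ?prime_gt0//.
  rewrite natr1 -natrM ler_nat; apply: leq_trans (_ : (N %/ p).+1 * p <= _)%N.
    by rewrite ltnW// ltn_ceil// prime_gt0.
  by rewrite leq_mul2r ltnS logn_fact// big_ltn//= expn1 leq_addr orbT.
rewrite -(ler_pM2l N0') mulrDr; have := ln_fact_le N; have := primes_log_sum_le N.
by move: h; set u := N%:R * primes_log_ratio_sum N; set v := N%:R * ln N%:R; set t := N%:R * ln 4; lra.
Qed.

(* Averaging [ln p / p] over the windows of length [n] inside [(n, K n]]. *)
Lemma prime_rich_window (K n : nat) : (0 < n)%N -> 4 + ln 4 <= ln K%:R :> R ->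
  exists2 j : nat, (0 < j)%N &
    n%:R * (ln K%:R - (4 + ln 4)) <=
    (\sum_(k < n | prime (j * n + 1 + k)) 1)%N%:R * (ln (K * n)%:R * (1 + ln K%:R)) :> R.
Proof.
move=> n0 lK; have n0' : 0 < n%:R :> R by rewrite ltr0n.
have ln4 : 0 <= ln 4 :> R by rewrite ln_ge0// ler1n.
have K2 : (1 < K)%N.
  rewrite ltnNge; apply/negP; case: K lK => [|[|//]] lK _; move: lK.
    by rewrite (ln0 (lexx 0)) => h; lra.
  by rewrite ln1 => h; lra.
apply: contrapT => /forall2NP hj.
pose L : R := ln (K * n)%:R.
pose cnt j := (\sum_(k < n | prime (j * n + 1 + k)) 1)%N.
have hj' j : (0 < j)%N -> (cnt j)%:R * L * (1 + ln K%:R) <= n%:R * (ln K%:R - (4 + ln 4)).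
  by move=> j0; have [//|/negP] := hj j; rewrite -ltNge mulrA => /ltW.
have win (k : nat) : (0 < k)%N ->
    primes_log_ratio_sum (k * n) - primes_log_ratio_sum n =
    \sum_(1 <= j < k) \sum_(j * n + 1 <= p < j * n + 1 + n | prime p) ln p%:R / p%:R.
  case: k => // k _; elim: k => [|k IH]; first by rewrite mul1n subrr big_geq.
  rewrite big_nat_recr//= -IH /primes_log_ratio_sum.
  rewrite (@big_cat_nat _ _ _ (k.+1 * n).+1 0 (k.+2 * n).+1)//=; last by rewrite ltnS leq_mul2r leqnSn orbT.
  rewrite addrAC; congr (_ + _); apply: congr_big_nat => //; lia.
have K0 : (0 < K)%N by lia.
have := win K K0.
(* A prime of window [j] contributes at most [ln (K n) / (j n)]. The assumed failure bounds the
   total of the window by a multiple of 1/j, and the harmonic sum below [K] is at most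
   [1 + ln K]. *)
have up : \sum_(1 <= j < K) \sum_(j * n + 1 <= p < j * n + 1 + n | prime p) ln p%:R / p%:R
   <= ln K%:R - (4 + ln 4) :> R.
  have lK0 : 0 < 1 + ln K%:R :> R by lra.
  apply: le_trans (_ : \sum_(1 <= j < K) (ln K%:R - (4 + ln 4)) / (1 + ln K%:R) * (j%:R)^-1 <= _).
    apply: ler_sum_nat => j /andP[j0 jK].
    have j0' : 0 < j%:R :> R by rewrite ltr0n.
    apply: le_trans (_ : (cnt j)%:R * L / (j%:R * n%:R) <= _); last first.
      rewrite ler_pdivrMr ?mulr_gt0//.
      have -> : (ln K%:R - (4 + ln 4)) / (1 + ln K%:R) / j%:R * (j%:R * n%:R) =
         n%:R * (ln K%:R - (4 + ln 4)) / (1 + ln K%:R) :> R.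
        by field; rewrite !gt_eqF.
      by rewrite ler_pdivlMr// hj'.
    rewrite -[X in \sum_(X <= _ < _ | _) _]add0n big_addn addnC addnK big_mkord.
    rewrite /cnt natr_sum -mulrA big_distrl/=.
    rewrite [leRHS](eq_bigl (fun k : 'I_n => prime (k + (j * n + 1)))); last by move=> k; rewrite addnC.
    apply: ler_sum => k pk; rewrite mul1r.
    have kn := ltn_ord k.
    apply: ler_pM; rewrite ?invr_ge0 ?ler0n ?ln_ge0 ?ler1n ?prime_gt0//.
      rewrite /L ler_ln ?posrE ?ltr0n ?muln_gt0 ?n0 ?K0 ?prime_gt0// ler_nat.
      by apply: leq_trans (_ : j.+1 * n <= _)%N; [lia|rewrite leq_mul2r jK orbT].
    have jn0 : (0 < j * n)%N by rewrite muln_gt0 j0.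
    have kjn0 : (0 < k + (j * n + 1))%N by lia.
    rewrite -natrM lef_pV2 ?posrE ?ltr0n// ler_nat; lia.
  rewrite -big_distrr/= -mulrA ler_piMr ?subr_ge0// ler_pdivrMl// mulr1.
  case: K K2 {lK hj L cnt hj' win K0 lK0} => [//|[//|z]] _.
  apply: le_trans (harmonic_le_ln R z) _; rewrite lerD2l ler_ln ?posrE ?ltr0n// ler_nat.
  exact: leqnSn.
(* Mertens' bounds leave at least [ln K - 3 - ln 4] on [(n, K n]], one more than [up] allows. *)
have := @primes_log_ratio_sum_ge (K * n); have := primes_log_ratio_sum_le n0.
rewrite natrM lnM ?posrE ?ltr0n// muln_gt0 K0 n0 => h1 /(_ isT) h2 h3.
move: up; rewrite -h3; lra.
Qed.

Lemma cpx_admissible_window (K n : nat) : (0 < n)%N -> 4 + ln 4 <= ln K%:R :> R ->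
  exists2 m : nat, (2 ^ m <= cpx admissible_subshift n)%N &
    n%:R * (ln K%:R - (4 + ln 4)) <= m%:R * (ln (K * n)%:R * (1 + ln K%:R)) :> R.
Proof.
move=> n0 lK; have [j j0 hj] := prime_rich_window n0 lK.
pose S := [set k : 'I_n | prime (j * n + 1 + k)]%SET.
exists #|S|; last by rewrite -sum1_card (eq_bigl (fun k : 'I_n => prime (j * n + 1 + k)))// => k; rewrite inE.
apply: cpx_admissible_ge => p pp; have [pn|np] := leqP p n; last first.
  by exists 1%N => k _; rewrite gtnNdvd ?addn1// (leq_ltn_trans _ np).
exists (j * n + 1)%N => k; rewrite inE => pk; rewrite addnC dvdn_prime2//.
apply/eqP => e; have : (n <= j * n)%N by rewrite leq_pmull.
lia.
Qed.

End Mertens.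

(** * Asymptotics *)

Section Asymptotics.
Local Open Scope classical_set_scope.
Variable R : realType.
Implicit Types (f : nat -> nat) (c : R).

Let g (n : nat) : R := n%:R / ln n%:R.

Lemma near_ln_ge (A : R) : \forall n \near \oo, A <= ln (n%:R : R).
Proof.
near=> n; rewrite -[leLHS]expRK.
have eA : expR A < n%:R.
  apply: lt_le_trans (truncnS_gt _) _; rewrite ler_nat; near: n; exact: nbhs_infty_ge.
by rewrite ler_ln ?posrE ?expR_gt0 ?ltW// (lt_trans _ eA) ?expR_gt0.
Unshelve. all: by end_near. Qed.

Lemma ln2_bounds : 2^-1 <= ln 2 :> R /\ ln 2 <= 1 :> R.
Proof.
have := @ln_succ_diff_ge R 1 isT; have := @ln_succ_diff_le R 1 isT.
by rewrite ln1 subr0 invr1.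
Qed.

Lemma ln_gt0_nat (n : nat) : 1 <= ln (n%:R : R) -> n%:R = expR (ln (n%:R : R)) :> R.
Proof.
move=> l1; rewrite lnK// posrE lt_neqAle ler0n andbT; apply/eqP => n0.
by move: l1; rewrite -n0 ln0//; lra.
Qed.

Lemma near_quot_gt0 : \forall n \near \oo, 0 < g n.
Proof.
near=> n; have l1 : 1 <= ln (n%:R : R) by near: n; exact: near_ln_ge.
by rewrite /g divr_gt0 ?(lt_le_trans _ l1)// ln_gt0_nat ?expR_gt0.
Unshelve. all: by end_near. Qed.

(** The exact base at [n] is the [g n]-th root [r n] of [f n]; the error sequence is its excess over
    [c], cut off at 0. *)
Lemma ll_pow_ln f c : 1 <= c ->
  (forall d, 0 < d -> \forall n \near \oo, (f n)%:R <= expR ((ln c + d) * g n)) ->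
  ll_pow (fun n => (f n)%:R : R) c g.
Proof.
move=> c1 hf; have c0 : 0 < c by apply: lt_le_trans c1.
pose r n := expR (ln (f n)%:R / g n).
exists 1, (fun n => Num.max 0 (r n - c)); split=> //.
  apply/cvgrPdist_le => e e0.
  have ce0 : 0 < c + e by rewrite addr_gt0.
  have d0 : 0 < ln (c + e) - ln c by rewrite subr_gt0 ltr_ln ?posrE// ltrDl.
  have hd := hf _ d0; near=> n.
  rewrite sub0r normrN ger0_norm ?le_max ?lexx// ge_max ltW//= lerBlDl.
  have g0 : 0 < g n by near: n; exact: near_quot_gt0.
  have : (f n)%:R <= expR ((ln c + (ln (c + e) - ln c)) * g n) by near: n.
  rewrite addrC subrK => fn; rewrite /r -[leRHS]lnK ?posrE// ler_expR ler_pdivrMr//.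
  (* If [f n = 0], then [ln 0 = 0] by convention, and [1 <= c] makes the right side nonnegative. *)
  have [->|fn0] := posnP (f n).
    by rewrite ln0// mulr_ge0 ?(ltW g0)// ln_ge0// (le_trans c1)// lerDl ltW.
  by rewrite -ler_expR lnK ?posrE ?ltr0n.
near=> n; have g0 : 0 < g n by near: n; exact: near_quot_gt0.
rewrite mul1r; have [->|fn0] := posnP (f n); first exact: powR_ge0.
apply: le_trans (_ : r n `^ g n <= _).
  by rewrite /r -expRM divfK ?gt_eqF// lnK// posrE ltr0n.
rewrite ge0_ler_powR ?nnegrE ?(ltW g0) ?expR_ge0//.
  by rewrite addr_ge0 ?(ltW c0)// le_max lexx.
by rewrite -lerBlDl le_max lexx orbT.
Unshelve. all: by end_near. Qed.

Lemma pow_ll_ln f c : 0 < c ->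
  (forall d, 0 < d -> \forall n \near \oo, expR ((ln c - d) * g n) <= (f n)%:R) ->
  pow_ll c g (fun n => (f n)%:R : R).
Proof.
move=> c0 hf.
pose r n := expR (ln (f n)%:R / g n).
exists 1, (fun n => Num.min 0 (r n - c)); split=> //.
  (* The cap [c / 2] keeps [c - e] positive, so that its logarithm is meaningful. *)
  apply/cvgrPdist_le => e0 e00; pose e := Num.min e0 (c / 2).
  have e1 : 0 < e by rewrite lt_min e00 divr_gt0.
  have ec : 0 < c - e by rewrite subr_gt0 gt_min; apply/orP; right; lra.
  have d0 : 0 < ln c - ln (c - e) by rewrite subr_gt0 ltr_ln ?posrE// ltrBlDr ltrDl.
  have hd := hf _ d0; near=> n.
  apply: le_trans (_ : e <= _); last by rewrite ge_min lexx.
  rewrite sub0r normrN ler0_norm ?ge_min ?lexx// lerNl le_min lerNl oppr0 ltW//=.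
  rewrite lerBrDl.
  have g0 : 0 < g n by near: n; exact: near_quot_gt0.
  have : expR ((ln c - (ln c - ln (c - e))) * g n) <= (f n)%:R by near: n.
  rewrite subKr => fn; rewrite /r -[leLHS]lnK ?posrE// ler_expR ler_pdivlMr//.
  by rewrite -ler_expR lnK ?posrE// (lt_le_trans _ fn) ?expR_gt0.
near=> n; have g0 : 0 < g n by near: n; exact: near_quot_gt0.
have fn : 0 < (f n)%:R :> R.
  have : expR ((ln c - 1) * g n) <= (f n)%:R by near: n; exact: hf.
  by apply: lt_le_trans; exact: expR_gt0.
rewrite mul1r; apply: le_trans (_ : r n `^ g n <= _); last first.
  by rewrite /r -expRM divfK ?gt_eqF// lnK.
have [h|h] := leP 0 (r n - c); rewrite ge0_ler_powR ?nnegrE ?(ltW g0) ?expR_ge0 ?addr0 ?(ltW c0)//.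
- by rewrite -subr_ge0.
- by rewrite addrC subrK expR_ge0.
- by rewrite addrC subrK.
Unshelve. all: by end_near. Qed.

Lemma pow_ln_le (n : nat) (m : nat) : 1 <= ln (n%:R : R) ->
  ln (n%:R : R) ^+ m.+1 <= m.+1%:R ^+ m.+1 * n%:R.
Proof.
by move=> l1; rewrite [in leRHS](ln_gt0_nat l1); apply: pow_le_expR; lra.
Qed.

Lemma cpx_admissible_upper (d : R) : 0 < d ->
  \forall n \near \oo, (cpx admissible_subshift n)%:R <= expR ((ln 4 + d) * g n).
Proof.
move=> d0; have [l2 l2'] := ln2_bounds.
have l4 : ln 4 = 2 * ln 2 :> R.
  by rewrite -[4%:R]/((2 * 2)%N%:R) natrM lnM ?posrE//; ring.
have l20 : 0 < ln 2 :> R by apply: lt_le_trans l2; rewrite invr_gt0.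
(* The sieve level is n^a. This [a] makes [ln 2 / a] equal to [ln 4 + d / 2], and [a < 1/2] leaves a
   factor n^t between n^(2a) and [n]. *)
pose a : R := ln 2 / (ln 4 + d / 2).
have l4d : 0 < ln 4 + d / 2 by lra.
have a0 : 0 < a by rewrite divr_gt0//; lra.
have a2 : a < 2^-1 by rewrite ltr_pdivrMr//; lra.
have [c4 c40 hc4] : exists2 c4 : R, 0 < c4 & forall y, 0 <= y -> y ^+ 4 <= c4 * expR y.
  by exists (4 ^+ 4); [rewrite exprn_gt0|exact: pow_le_expR].
pose t : R := 1 - 2 * a.
have t0 : 0 < t by rewrite /t; lra.
near=> n.
have L1 : 1 <= ln (n%:R : R) by near: n; exact: near_ln_ge.
(* This threshold turns [(t * L) ^+ 4 <= c4 * expR (t * L)] into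
   [20 * L ^+ 3 <= d * expR (t * L)]. *)
have Lbig : 20 * c4 / (d * t ^+ 4) <= ln (n%:R : R) by near: n; exact: near_ln_ge.
set L := ln (n%:R : R) in L1 Lbig.
have nE : n%:R = expR L := ln_gt0_nat L1.
pose x := expR (a * L); pose z := Num.truncn x.
have aL : 0 <= a * L by rewrite mulr_ge0 ?(ltW a0)//; lra.
have x1 : 1 <= x by rewrite -expR0 ler_expR.
have x0 : 0 < x by exact: expR_gt0.
have L0 : 0 < L by apply: lt_le_trans L1.
have zx : z%:R <= x by rewrite truncn_le ltW.
have z0 : (0 < z)%N by rewrite truncn_gt0.
have xz : a * L <= ln z.+1%:R.
  by rewrite -ler_expR lnK ?posrE ?ltr0n// ltW// truncnS_gt.
have z0' : 0 < z%:R :> R by rewrite ltr0n.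
have lz : ln z%:R <= a * L by rewrite -ler_expR lnK ?posrE.
have tl : (trunc_log 2 z)%:R + 1 <= 3 * L.
  have : (trunc_log 2 z)%:R * ln 2 <= ln z%:R :> R.
    rewrite mulr_natl -lnXn// ler_ln ?posrE ?exprn_gt0// -natrX ler_nat.
    exact: trunc_logP.
  have : a * L <= 2^-1 * L by rewrite ler_wpM2r ?ltW//; lra.
  move: lz l2; set T : R := (trunc_log 2 z)%:R; have T0 : 0 <= T by rewrite ler0n.
  nra.
pose B : R := g n / a + 9 * (x ^+ 2 * L ^+ 2).
have gE : n%:R = g n * L by rewrite /g divfK// gt_eqF//; apply: lt_le_trans L1.
have g0 : 0 < g n by rewrite /g divr_gt0 ?nE ?expR_gt0 ?expRK//; apply: lt_le_trans L1.
have B0 : 0 <= B.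
  apply: addr_ge0; first by apply: divr_ge0; exact: ltW.
  by apply: mulr_ge0 => //; apply: mulr_ge0; apply: exprn_ge0; exact: ltW.
have sB (c : nat) :
    (#|[set k : 'I_n | [forall p : 'I_z.+1, prime p ==> ~~ (p %| k + c)%N]]%SET| <= Num.truncn B)%N.
  rewrite truncn_ge_nat//.
  apply: le_trans (sifted_card_le R n c z0) _; apply: lerD.
    have lz1 : 0 < ln z.+1%:R :> R by apply: lt_le_trans xz; exact: mulr_gt0.
    by rewrite gE ler_pdivrMr// [leRHS]mulrAC ler_pdivlMr// -[leLHS]mulrA ler_pM2l// mulrC.
  have -> : 9 * (x ^+ 2 * L ^+ 2) = (x * (3 * L)) ^+ 2 by ring.
  have le1 : z%:R * ((trunc_log 2 z)%:R + 1) <= x * (3 * L).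
    by apply: ler_pM => //; rewrite addr_ge0.
  by rewrite lerXn2r// nnegrE; [rewrite mulr_ge0// addr_ge0|apply: le_trans le1; rewrite mulr_ge0// addr_ge0].
have cpx_le := cpx_admissible_le sB.
apply: le_trans (_ : (z`! * 2 ^ Num.truncn B)%:R <= _); first by rewrite ler_nat.
have zf : z`!%:R <= expR (x * L).
  rewrite -[leLHS]lnK ?posrE ?ltr0n ?fact_gt0// ler_expR.
  apply: le_trans (ln_fact_le R z) _; apply: ler_pM; rewrite ?ler0n ?ln_ge0 ?ler1n//.
  by apply: le_trans lz _; nra.
have p2 : (2 ^ Num.truncn B)%:R <= expR (ln 2 * B).
  rewrite natrX -[2%:R](lnK (_ : 2%:R \in Num.pos)) ?posrE// -expRM_natr ler_expR.
  by rewrite expRK ler_wpM2l ?truncn_le//; lra.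
apply: le_trans (_ : expR (x * L) * expR (ln 2 * B) <= _).
  by rewrite natrM ler_pM.
rewrite -expRD ler_expR /B {p2 zf cpx_le sB B0}.
have -> : ln 2 * (g n / a + 9 * (x ^+ 2 * L ^+ 2)) =
    (ln 4 + d / 2) * g n + ln 2 * 9 * (x ^+ 2 * L ^+ 2).
  have la : ln 2 / a = ln 4 + d / 2.
    by rewrite /a invf_div mulrCA divff ?mulr1// gt_eqF.
  by rewrite -la mulrDr [LHS]addrC mulrA [LHS]addrC; congr (_ + _); rewrite mulrCA mulrC.
have xx : x <= x ^+ 2 by rewrite expr2 ler_peMl// (le_trans _ x1).
(* One copy of [x ^+ 2 * L ^+ 2] absorbs the logarithm of [z!] and nine absorb the sieve error;
   together they fit into the remaining [d / 2]. *)
have key : 10 * (x ^+ 2 * L ^+ 2) <= d / 2 * g n.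
  have tL0 : 0 <= t * L by apply: mulr_ge0; exact: ltW.
  have tL := hc4 _ tL0.
  have xE : x ^+ 2 * expR (t * L) = n%:R.
    by rewrite nE /x -expRM_natr -expRD; congr expR; rewrite /t; ring.
  have x20 : 0 < x ^+ 2 by rewrite exprn_gt0.
  have dt0 : 0 < d * t ^+ 4 by rewrite mulr_gt0 ?exprn_gt0.
  rewrite -(ler_pM2r L0) -[leRHS]mulrA -gE -xE.
  move: Lbig; rewrite ler_pdivrMr// => Lbig.
  have h : 20 * L ^+ 3 <= d * expR (t * L).
    have cLt : 0 < c4 * (L * t ^+ 4) by rewrite !mulr_gt0 ?exprn_gt0.
    rewrite -(ler_pM2l cLt).
    have -> : c4 * (L * t ^+ 4) * (d * expR (t * L)) = L * (d * t ^+ 4) * (c4 * expR (t * L)) by ring.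
    have -> : c4 * (L * t ^+ 4) * (20 * L ^+ 3) = 20 * c4 * (t * L) ^+ 4 by ring.
    by apply: ler_pM => //; [apply: mulr_ge0 => //; exact: ltW|exact: exprn_ge0].
  have -> : 10 * (x ^+ 2 * L ^+ 2) * L = x ^+ 2 / 2 * (20 * L ^+ 3) by field.
  have -> : d / 2 * (x ^+ 2 * expR (t * L)) = x ^+ 2 / 2 * (d * expR (t * L)) by field.
  by rewrite ler_wpM2l// divr_ge0 ?ltW.
have L2 : L <= L ^+ 2 by rewrite expr2 ler_peMl//; lra.
have h1 : x * L <= x ^+ 2 * L ^+ 2 by apply: ler_pM => //; [exact: expR_ge0|lra].
have h2 : ln 2 * 9 * (x ^+ 2 * L ^+ 2) <= 9 * (x ^+ 2 * L ^+ 2).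
  by rewrite ler_wpM2r//; [rewrite mulr_ge0// exprn_ge0// ltW|lra].
move: key h1 h2; set X := x ^+ 2 * L ^+ 2; set Y := ln 2 * 9 * X; lra.
Unshelve. all: by end_near. Qed.

Lemma cpx_admissible_lower (d : R) : 0 < d ->
  \forall n \near \oo, expR ((ln 2 - d) * g n) <= (cpx admissible_subshift n)%:R.
Proof.
move=> d0; have [l2 l2'] := ln2_bounds.
have [c1 c1E] : exists c1 : R, c1 = 4 + ln 4 by exists (4 + ln 4).
have c10 : 0 < c1 by rewrite c1E ltr_pwDl// ln_ge0// ler1n.
(* Two factors [1 - e] will be lost, one from the choice of [K] and one from [ln n / ln (K n)];
   [(1 - e)^2 >= 1 - 2 e] and [2 e <= d] make this affordable. *)
pose e : R := Num.min (d / 2) 1.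
have e0 : 0 < e by rewrite lt_min ltr01 divr_gt0.
have e1 : e <= 1 by rewrite ge_min lexx orbT.
have ed : 2 * e <= d.
  have : e <= d / 2 by rewrite ge_min lexx.
  lra.
(* [K] is fixed before [n], with [ln K] so large that [(ln K - c1) / (1 + ln K) >= 1 - e]. *)
pose K := (Num.truncn (expR (c1 + (c1 + 1) / e))).+1; pose l := ln (K%:R : R).
have lK : c1 + (c1 + 1) / e <= l.
  by rewrite -ler_expR /l lnK ?posrE ?ltr0n// ltW// truncnS_gt.
have ce : 0 < (c1 + 1) / e by rewrite divr_gt0 ?addr_gt0.
near=> n.
have L1 : 1 <= ln (n%:R : R) by near: n; exact: near_ln_ge.
have Lbig : l / e <= ln (n%:R : R) by near: n; exact: near_ln_ge.
set L := ln (n%:R : R) in L1 Lbig.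
have nE : n%:R = expR L := ln_gt0_nat L1.
have n0 : (0 < n)%N by rewrite -(ltr0n R) nE expR_gt0.
have gE : n%:R = g n * L by rewrite /g divfK// gt_eqF//; apply: lt_le_trans L1.
have g0 : 0 < g n by rewrite /g divr_gt0 ?nE ?expR_gt0 ?expRK//; apply: lt_le_trans L1.
have lK' : 4 + ln 4 <= ln (K%:R : R).
  by rewrite -c1E; apply: le_trans lK; rewrite lerDl ltW.
have [m m1 m2] := cpx_admissible_window n0 lK'.
apply: le_trans (_ : (2 ^ m)%:R <= _); last by rewrite ler_nat.
rewrite natrX -[2%:R in leRHS](lnK (_ : 2%:R \in Num.pos)) ?posrE// -expRM_natr ler_expR.
move: m2; rewrite natrM lnM ?posrE ?ltr0n// -/l -/L -c1E gE => m2.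
have A1 : (1 - e) * (1 + l) <= l - c1.
  have : (c1 + 1) <= e * l.
    rewrite mulrC -ler_pdivrMr//; apply: le_trans lK; lra.
  nra.
have A2 : (1 - e) * (l + L) <= L.
  have : l <= e * L by rewrite mulrC -ler_pdivrMr.
  have : 0 <= e * l by rewrite mulr_ge0 ?ltW//; lra.
  lra.
have l0 : 0 < l by lra.
have L0 : 0 < L by lra.
have mm : (1 - e) ^+ 2 * g n <= m%:R.
  rewrite -(ler_pM2r (_ : 0 < (l + L) * (1 + l))) ?mulr_gt0 ?addr_gt0//.
  apply: le_trans m2.
  have -> : (1 - e) ^+ 2 * g n * ((l + L) * (1 + l)) =
     g n * (((1 - e) * (l + L)) * ((1 - e) * (1 + l))) by ring.
  rewrite -[leRHS]mulrA ler_pM2l//.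
  by apply: ler_pM => //; rewrite mulr_ge0 ?subr_ge0// ltW ?addr_gt0.
apply: le_trans (_ : ln 2 * ((1 - e) ^+ 2 * g n) <= _); last by rewrite ler_wpM2l//; lra.
rewrite [leRHS]mulrA ler_wpM2r ?(ltW g0)//.
have : 0 <= e ^+ 2 by rewrite sqr_ge0.
nra.
Unshelve. all: by end_near. Qed.

(** This lets a factor 2 absorb the words of the primes near the origin. *)
Lemma near_linear_le_cpx_admissible :
  \forall n \near \oo, ((4 * n).+1 <= cpx admissible_subshift n)%N.
Proof.
have [l2 l2'] := ln2_bounds.
have l20 : 0 < ln 2 / 2 :> R by lra.
have := cpx_admissible_lower l20; move=> lo; near=> n.
(* With [L ^+ 3 <= 27 n], this gives [5 * L ^+ 2 <= n / 4], hence [4 + L <= (ln 2 / 2) * g n]. *)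
have L1 : 1000 <= ln (n%:R : R) by near: n; exact: near_ln_ge.
rewrite -(ler_nat R); apply: le_trans (_ : expR ((ln 2 - ln 2 / 2) * g n) <= _); last by near: n.
set L := ln (n%:R : R) in L1.
have L1' : 1 <= L by lra.
have nE : n%:R = expR L := ln_gt0_nat L1'.
have n0 : (0 < n)%N by rewrite -(ltr0n R) nE expR_gt0.
apply: le_trans (_ : 5 * n%:R <= _).
  have -> : 5 * n%:R = (5 * n)%:R :> R by rewrite natrM.
  by rewrite ler_nat; lia.
apply: le_trans (_ : expR (4 + L) <= _).
  rewrite expRD -nE ler_wpM2r//; apply: le_trans (expR_ge1Dx _); lra.
rewrite ler_expR /g -/L mulrA ler_pdivlMr ?(lt_le_trans _ L1')//.
have := @pow_ln_le n 2 L1'; rewrite -/L -natrX => L3.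
have L20 : 0 <= L ^+ 2 by rewrite sqr_ge0.
have h : L ^+ 3 = L * L ^+ 2 by rewrite exprS.
have h' : (4 + L) * L <= 5 * L ^+ 2 by nra.
have h27 : (3 ^ 3)%N%:R = 27 :> R by [].
have n0' : 0 < n%:R :> R by rewrite ltr0n.
have : 1000 * L ^+ 2 <= 27 * n%:R by rewrite -h27; apply: le_trans L3; rewrite h; exact: (ler_wpM2r L20 L1).
have : 4^-1 * n%:R <= (ln 2 - ln 2 / 2) * n%:R :> R by rewrite ler_wpM2r//; lra.
move: h'; lra.
Unshelve. all: by end_near. Qed.

End Asymptotics.

(** It lets the additive 1 of [cpx_admissible_le_primes] be absorbed by halving the constant. *)
Lemma cpx_primes_gt0 n : (0 < cpx primes_subshift n)%N.
Proof.
pose y := sym_indicator [set p | prime p]%classic.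
apply/card_gt0P; exists [tuple y (k : 'I_n)%:Z | k < n]; rewrite inE.
apply/asboolP/occurs_orbit_closureP; exists 0 => k.
by rewrite tnth_mktuple add0r.
Qed.

Local Open Scope classical_set_scope.

Theorem theorem1p1 (R : realType) :
  [/\ ll_pow (fun n : nat => (cpx primes_subshift n)%:R : R)
        4 (fun n : nat => n%:R / ln n%:R),
      pow_ll (2 : R) (fun n : nat => n%:R / ln n%:R)
        (fun n : nat => (cpx admissible_subshift n)%:R),
      ll_pow (fun n : nat => (cpx admissible_subshift n)%:R : R)
        4 (fun n : nat => n%:R / ln n%:R)
    & hardy_littlewood R ->
      pow_ll (2 : R) (fun n : nat => n%:R / ln n%:R)
        (fun n : nat => (cpx primes_subshift n)%:R)].
Proof.
have upper : ll_pow (fun n => (cpx admissible_subshift n)%:R : R) 4 (fun n => n%:R / ln n%:R).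
  by apply: ll_pow_ln => [|d d0]; [rewrite ler1n|exact: cpx_admissible_upper].
have lower : pow_ll (2 : R) (fun n => n%:R / ln n%:R) (fun n => (cpx admissible_subshift n)%:R).
  by apply: pow_ll_ln => // d d0; exact: cpx_admissible_lower.
split=> //.
  have [C [eps [C0 eps0 hC]]] := upper.
  exists (2 * C), eps; split=> //; first exact: mulr_gt0.
  have lin := near_linear_le_cpx_admissible R; near=> n.
  have Cn : (cpx admissible_subshift n)%:R <= C * (4 + eps n) `^ (n%:R / ln n%:R) by near: n.
  rewrite -mulrA; apply: le_trans (ler_wpM2l (ler0n _ 2) Cn).
  rewrite -natrM ler_nat mul2n -addnn.
  apply: leq_trans (cpx_primes_le n) _; rewrite leq_add2l; near: n; exact: lin.
move=> HL; have [C [eps [C0 eps0 hC]]] := lower.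
exists (C / 2), eps; split=> //; first exact: divr_gt0.
near=> n.
have Cn : C * (2 + eps n) `^ (n%:R / ln n%:R) <= (cpx admissible_subshift n)%:R by near: n.
rewrite mulrAC ler_pdivrMr//; apply: le_trans Cn _; rewrite -natrM ler_nat muln2 -addnn.
apply: leq_trans (cpx_admissible_le_primes HL n) _; rewrite leq_add2l.
exact: cpx_primes_gt0.
Unshelve. all: by end_near. Qed.
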